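(* Let $k\ge2$, $0\le\alpha<1$, let $G$ be a connected $k$-uniform hypergraph with at least one edge, and let $u\in V(G)$. For all integers $p\ge q\ge1$, \[\rho_\alpha(G_u(p,q))>\rho_\alpha(G_u(p+1,q-1)).\]
   Context: Hypergraphs are finite with edges being sets; $k$-uniform means every edge has $k$ vertices. $\mathcal A_\alpha(G)=\alpha\mathcal D(G)+(1-\alpha)\mathcal A(G)$, where $\mathcal A(G)$ is the order-$k$ tensor with $(i_1,\dots,i_k)$-entry $\frac1{(k-1)!}$ if $\{i_1,\dots,i_k\}\in E(G)$ and $0$ otherwise, and $\mathcal D(G)$ is the diagonal tensor of vertex degrees; for an order-$k$ tensor $\mathcal T$, $(\mathcal Tx)_i=\sum_{i_2,\dots,i_k}\mathcal T_{ii_2\dots i_k}x_{i_2}\cdots x_{i_k}$ and $\lambda$ is an eigenvalue if $\mathcal Tx=\lambda x^{[k-1]}$ for some $x\neq0$; $\rho_\alpha(G)$ is the largest modulus of an eigenvalue of $\mathcal A_\alpha(G)$. Connected: any two vertices are joined by a path. For a $k$-uniform hypergraph $H$, a vertex $u\in V(H)$ and $s\ge1$, $H_u(s)$ denotes the hypergraph obtained from $H$ by attaching a pendant loose path of length $s$ at $u$: add new vertices $w_1,\dots,w_s$ and new edges $f_1,\dots,f_s$, where $f_i$ consists of $w_{i-1},w_i$ (with $w_0=u$) and $k-2$ further new vertices, all new vertices being distinct and not in $V(H)$. Set $H_u(0)=H$. For $p\ge q\ge0$, $G_u(p,q)=(G_u(p))_u(q)$. *)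

(* Defs.v *)
From HB Require Import structures.
From mathcomp Require Import all_boot all_order all_algebra.
Unset Printing Implicit Defensive.
Import Order.TTheory GRing.Theory Num.Theory.

Record hypergraph := HG { vtx : finType; edges : {set {set vtx}} }.

Definition uniform (k : nat) (H : hypergraph) : Prop :=
  forall e, e \in edges H -> #|e| = k.

Definition adjrel (H : hypergraph) : rel (vtx H) :=
  fun a b => [exists e in edges H, (a \in e) && (b \in e)].
Definition connected (H : hypergraph) : Prop :=
  forall x y : vtx H, connect (adjrel H) x y.

(* Pendant loose path of length s attached at u (for k-uniform graphs, k >= 2).
   New vertices are inr (i, j), i < s, j < k-1; w_i := inr (i, 0), w_0 := u.
   Edge f_i (i < s) = {w_(i-1)} u {inr (i, j) | j < k-1}. *)
Definition pendant_edge (k : nat) (H : hypergraph) (u : vtx H) (s : nat)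
  (i : 'I_s) : {set (vtx H + ('I_s * 'I_k.-1))%type} :=
  [set x | match x with
           | inl v => (v == u) && (val i == 0%N)
           | inr (i', j) => (val i' == val i) || ((val i').+1 == val i) && (val j == 0%N)
           end].

Definition lift_edge (V W : finType) (e : {set V}) : {set (V + W)%type} :=
  [set inl x | x in e].

Definition attach (k : nat) (H : hypergraph) (u : vtx H) (s : nat) : hypergraph :=
  @HG (vtx H + ('I_s * 'I_k.-1))%type
      ([set lift_edge (vtx H) ('I_s * 'I_k.-1)%type e | e in edges H] :|: [set pendant_edge k H u s i | i : 'I_s]).

Definition Gupq (k : nat) (G : hypergraph) (u : vtx G) (p q : nat) : hypergraph :=
  attach k (attach k G u p) (inl u) q.

Section Tensor.
Variable C : numClosedFieldType.
Local Open Scope ring_scope.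

(* An order-k tensor over V is given by its entries T_{i i_2 ... i_k},
   with (i_2,...,i_k) encoded as t : {ffun 'I_k.-1 -> V}. *)
Definition deg (H : hypergraph) (i : vtx H) : nat := #|[set e in edges H | i \in e]|.

Definition adj_entry (k : nat) (H : hypergraph) (i : vtx H)
  (t : {ffun 'I_k.-1 -> vtx H}) : C :=
  if (i |: [set t j | j in 'I_k.-1]) \in edges H then ((k.-1)`!%:R)^-1 else 0.

Definition diag_entry (k : nat) (H : hypergraph) (i : vtx H)
  (t : {ffun 'I_k.-1 -> vtx H}) : C :=
  if [forall j, t j == i] then (deg H i)%:R else 0.

Definition Aalpha_entry (k : nat) (alpha : C) (H : hypergraph) (i : vtx H)
  (t : {ffun 'I_k.-1 -> vtx H}) : C :=
  alpha * diag_entry k H i t + (1 - alpha) * adj_entry k H i t.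

Definition Aalpha_apply (k : nat) (alpha : C) (H : hypergraph) (x : vtx H -> C)
  (i : vtx H) : C :=
  \sum_(t : {ffun 'I_k.-1 -> vtx H}) Aalpha_entry k alpha H i t * \prod_(j < k.-1) x (t j).

Definition is_eigenvalue (k : nat) (alpha : C) (H : hypergraph) (lam : C) : Prop :=
  exists x : vtx H -> C, (exists i, x i != 0) /\
    forall i, Aalpha_apply k alpha H x i = lam * x i ^+ k.-1.

Definition is_spectral_radius (k : nat) (alpha : C) (H : hypergraph) (r : C) : Prop :=
  (exists lam, is_eigenvalue k alpha H lam /\ `|lam| = r) /\
  (forall lam, is_eigenvalue k alpha H lam -> `|lam| <= r).
End Tensor.

(* Main.v *)
Require Import Defs.
From Stdlib Require Import Classical FunctionalExtensionality.
From HB Require Import structures.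
From mathcomp Require Import all_boot all_order all_algebra.
From mathcomp Require Import ring lra zify.
From mathcomp Require Import polyrcf ordered_qelim qe_rcf.
Import Order.TTheory GRing.Theory Num.Theory.
Local Open Scope ring_scope.
Set Implicit Arguments. Unset Strict Implicit. Unset Printing Implicit Defensive.

(** With F x i the sum over the edges e containing i of a x_i^k + (1 - a) prod_(w in e) x_w,
    a positive solution of F x = r x^k gives the spectral radius r, since AM-GM on each edge
    yields sum F y <= r sum y^k for all y >= 0.  Such a solution is a minimizer of the r for
    which F x <= r x^k has a positive solution.  The field need not be complete or archimedean,
    so the minimum is obtained by quantifier elimination over the real closed subfield of C:
    definable bounded sets have suprema.

    Along a pendant path the k/2-th powers of the values at the joints satisfy a linear
    three-term recurrence, so a path of length s contributes a + d Z_s / Z_(s+1) times x_u^k at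
    its root u, where Z_(m+2) = t Z_(m+1) - Z_m is determined by the eigenvalue alone.  At
    the radius r of G_u(p+1, q-1), identities for Z show that the lengths (p, q) contribute
    strictly more at u than (p+1, q-1).  Gluing paths of lengths p and q to the restriction of
    the eigenvector to G gives y on G_u(p, q) with F y >= r y^k, strictly at u. *)

(** * Real elements of a closed field *)

(** The real elements are packed into a type so that they can carry the real closed field structure
    on which quantifier elimination operates. *)
Record realOf (C : numClosedFieldType) :=
  RealOf { complexOf : C; complexOf_real : complexOf \is Num.real }.

Section RealSubfield.
Variable C : numClosedFieldType.
Local Notation R := (realOf C).

HB.instance Definition _ := [isSub for @complexOf C].
HB.instance Definition _ := [Choice of R by <:].
HB.instance Definition _ := [SubChoice_isSubComUnitRing of R by <:].
HB.instance Definition _ := [SubComUnitRing_isSubIntegralDomain of R by <:].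
HB.instance Definition _ := [SubIntegralDomain_isSubField of R by <:].
Local Notation v := (@complexOf C).

Let leR (x y : R) := v x <= v y.
Let ltR (x y : R) := v x < v y.
Let normR (x : R) : R := RealOf (normr_real (v x)).

Fact realOf_le0_add x y : leR 0 x -> leR 0 y -> leR 0 (x + y).
Proof. exact: addr_ge0. Qed.
Fact realOf_le0_mul x y : leR 0 x -> leR 0 y -> leR 0 (x * y).
Proof. exact: mulr_ge0. Qed.
Fact realOf_le0_anti x : leR 0 x -> leR x 0 -> x = 0.
Proof. by move=> x0 x1; apply/val_inj/eqP; rewrite eq_le; apply/andP. Qed.
Fact realOf_sub_ge0 x y : leR 0 (y - x) = leR x y.
Proof. exact: subr_ge0. Qed.
Fact realOf_le0_total x : leR 0 x || leR x 0.
Proof. exact: complexOf_real. Qed.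
Fact realOf_normN x : normR (- x) = normR x.
Proof. by apply: val_inj; rewrite /= normrN. Qed.
Fact realOf_ge0_norm x : leR 0 x -> normR x = x.
Proof. by move=> x0; apply: val_inj; rewrite /= ger0_norm. Qed.
Fact realOf_lt_def x y : ltR x y = (y != x) && leR x y.
Proof. by rewrite /ltR lt_def. Qed.

HB.instance Definition _ := Num.IntegralDomain_isLeReal.Build R
  realOf_le0_add realOf_le0_mul realOf_le0_anti realOf_sub_ge0
  realOf_le0_total realOf_normN realOf_ge0_norm realOf_lt_def.

Lemma complexOf_le (x y : R) : (x <= y) = (v x <= v y). Proof. by []. Qed.
Lemma complexOf_lt (x y : R) : (x < y) = (v x < v y). Proof. by []. Qed.

HB.instance Definition _ := GRing.RMorphism.copy (@complexOf C) (val : R -> C).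

Lemma conj_val (x : R) : (v x)^* = val x.
Proof. exact/CrealP/complexOf_real. Qed.

(** The coefficients are the sum and the product of z and its conjugate, both fixed by
    conjugation. *)
Lemma conj_pair_quadratic (z : C) : exists d : {poly R},
  size d = 3%N /\ forall y : C, (map_poly v d).[y] = (y - z) * (y - z^*).
Proof.
have r1 : z + z^* \is Num.real by apply/CrealP; rewrite rmorphD /= conjCK addrC.
have r2 : z * z^* \is Num.real by rewrite -normCK rpredX ?normr_real.
pose b : R := RealOf r1; pose c : R := RealOf r2.
exists ('X ^+ 2 - b *: 'X + c%:P); split=> [|y].
  rewrite -addrA size_polyDl size_polyXn // ltnS.
  by rewrite (leq_trans (size_polyD _ _)) // geq_max size_polyN (leq_trans (size_scale_leq _ _)) ?size_polyX // (leq_trans (size_polyC_leq1 _)).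
rewrite !(rmorphD, rmorphN) /= map_polyXn map_polyZ /= map_polyX map_polyC /=.
rewrite !(hornerE, hornerXn) /=.
by ring.
Qed.

(** Real coefficients make the conjugate of z a second root of p. The remainder of p modulo d then
    has two distinct roots but degree at most 1, so it vanishes. *)
Lemma quadratic_dvdp (p d : {poly R}) (z : C) :
    size d = 3%N -> (forall y, (map_poly v d).[y] = (y - z) * (y - z^*)) ->
    z \isn't Num.real -> root (map_poly v p) z -> (d %| p)%R.
Proof.
move=> sd dE zNreal pz.
have pz' : root (map_poly v p) z^*.
  have -> : map_poly v p = map_poly Num.conj (map_poly v p).
    by apply/polyP=> i; rewrite !coef_map /= conj_val.
  by rewrite fmorph_root.
have zz' : z != z^* by apply: contra zNreal => /eqP zE; apply/CrealP.
have d0 : d != 0 by rewrite -size_poly_eq0 sd.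
rewrite /dvdp; apply: contraT => r0.
have mE : map_poly v (p %% d) = map_poly v p - map_poly v (p %/ d) * map_poly v d.
  by rewrite -rmorphM -rmorphB /= {2}(divp_eq p d) addrC addKr.
have: (size [:: z; z^*] < size (map_poly v (p %% d)))%N.
  apply: max_poly_roots; rewrite ?map_poly_eq0 //=; last by rewrite inE zz'.
  by rewrite mE !rootE !hornerE !dE !subrr !(mul0r, mulr0) (rootP pz) (rootP pz') subr0 eqxx.
rewrite size_map_poly /=; have := ltn_modp p d; rewrite d0 sd => h1 h2.
by have := leq_trans h2 h1; rewrite ltnn.
Qed.

(* Real roots outside [a, b] and conjugate pairs of roots contribute equal signs at a and b. *)
Lemma no_root_same_sign (a b : R) (p : {poly R}) :
  (forall x, a <= x <= b -> ~~ root p x) -> a <= b -> 0 < p.[a] * p.[b].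
Proof.
have [n] := ubnP (size p); elim: n p => // n IHn p sp proot ab.
have [s1|s1] := leqP (size p) 1.
  have [c pc] : exists c, p = c%:P by exists p`_0; apply: size1_polyC.
  have c0 : c != 0 by have := proot a; rewrite lexx ab pc rootC => /(_ isT).
  by rewrite pc !hornerE -expr2 exprn_even_gt0.
have [z pz] : exists z, root (map_poly v p) z.
  by apply/closed_rootP; rewrite size_map_poly neq_ltn s1 orbT.
have [zreal|zNreal] := boolP (z \is Num.real).
  pose r : R := RealOf zreal.
  have /factor_theorem [q pE] : root p r by rewrite -(fmorph_root v).
  have p0 : q != 0.
    by apply: contraTneq s1 => q0; rewrite pE q0 mul0r size_poly0.
  have sq : (size q < n)%N.
    by move: sp; rewrite pE size_Mmonic ?monicXsubC // size_XsubC addn2.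
  have /IHn : (size q < n)%N by [].
  move=> /(_ _ ab) H; rewrite pE !hornerM ?hornerXsubC mulrACA mulr_gt0 ?H //.
    by move=> x xab; apply: contra (proot x xab) => qx; rewrite pE rootM qx.
  have : ~~ (a <= r <= b).
    by apply: contraL isT => /proot; rewrite pE rootM root_XsubC eqxx orbT.
  by rewrite negb_and -!ltNge => /orP[] h; nra.
have [d [sd dE]] := conj_pair_quadratic z.
have /dvdpP [q pE] := quadratic_dvdp sd dE zNreal pz.
have q0 : q != 0 by apply: contraTneq s1 => q0; rewrite pE q0 mul0r size_poly0.
have d0 : d != 0 by rewrite -size_poly_eq0 sd.
have dpos (x : R) : 0 < d.[x].
  rewrite complexOf_lt -horner_map dE.
  have -> : v x - z^* = (v x - z)^* by rewrite rmorphB /= conj_val.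
  rewrite -normCK exprn_gt0 // normr_gt0 subr_eq0.
  by apply: contraNneq zNreal => <-; apply: complexOf_real.
have sq : (size q < n)%N.
  by move: sp; rewrite pE size_mul // sd addn3 /= => h; apply: ltnW.
rewrite pE !hornerM ?hornerXsubC mulrACA mulr_gt0 //; last by rewrite mulr_gt0.
apply: IHn => // x xab.
by apply: contra (proot x xab) => qx; rewrite pE rootM qx.
Qed.

Fact realOf_ivt : Num.real_closed_axiom R.
Proof.
move=> p a b ab /andP[pa pb].
have [[x [h1 h2]]|h] := classic (exists x, a <= x <= b /\ root p x).
  by exists x.
suff: 0 < p.[a] * p.[b] by rewrite ltNge mulr_le0_ge0.
apply: no_root_same_sign => //.
by move=> x xab; apply/negP=> px; apply: h; exists x.
Qed.

HB.instance Definition _ := Num.RealField_isClosed.Build R realOf_ivt.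
End RealSubfield.

(** * Semialgebraic compactness *)

Section Definability.
Variable R : rcfType.
Implicit Types (P Q : (nat -> R) -> Prop) (f g : (nat -> R) -> R).

(** Environments are functions on all indices, read off a finite sequence padded with 0, so that no
    arity has to be tracked. *)
Definition definable P :=
  exists F : ord.formula R, forall e : seq R, ord.holds e F <-> P (fun i => e`_i).

Definition term_definable f :=
  exists t : GRing.term R, forall e : seq R, GRing.eval e t = f (fun i => e`_i).

Definition update (e : nat -> R) (i : nat) (a : R) : nat -> R :=
  fun j => if j == i then a else e j.

Lemma nth_set_nth_update (e : seq R) i a :
  (fun j => (set_nth 0 e i a)`_j) = update (fun j => e`_j) i a.
Proof. by apply: functional_extensionality => j; rewrite nth_set_nth. Qed.

Lemma eq_definable P Q : (forall e, P e <-> Q e) -> definable P -> definable Q.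
Proof. by move=> PQ [F FP]; exists F => e; rewrite FP PQ. Qed.

Lemma eq_term_definable f g : (forall e, f e = g e) -> term_definable f -> term_definable g.
Proof. by move=> fg [t tf]; exists t => e; rewrite tf fg. Qed.

Lemma definable_and P Q : definable P -> definable Q -> definable (fun e => P e /\ Q e).
Proof. by move=> [F hF] [G hG]; exists (ord.And F G) => e /=; rewrite hF hG. Qed.

Lemma definable_not P : definable P -> definable (fun e => ~ P e).
Proof. by move=> [F hF]; exists (ord.Not F) => e /=; rewrite hF. Qed.

Lemma definable_true : definable (fun=> Logic.True).
Proof. by exists (ord.Bool true). Qed.

Lemma definable_le f g :
  term_definable f -> term_definable g -> definable (fun e => f e <= g e).
Proof. by move=> [t ht] [u hu]; exists (ord.Le t u) => e /=; rewrite ht hu. Qed.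

Lemma definable_lt f g :
  term_definable f -> term_definable g -> definable (fun e => f e < g e).
Proof. by move=> [t ht] [u hu]; exists (ord.Lt t u) => e /=; rewrite ht hu. Qed.

Lemma definable_exists i P :
  definable P -> definable (fun e => exists a, P (update e i a)).
Proof.
move=> [F hF]; exists (ord.Exists i F) => e /=.
by split=> -[a h]; exists a; move: h; rewrite hF nth_set_nth_update.
Qed.

Lemma definable_all (I : finType) (A : {pred I}) (P : I -> (nat -> R) -> Prop) :
  (forall i, definable (P i)) -> definable (fun e => forall i, i \in A -> P i e).
Proof.
move=> dP; suff: definable (fun e => forall i, i \in enum A -> P i e).
  by apply: eq_definable => e; split=> h i; have := h i; rewrite mem_enum.
elim: (enum A) => [|a s IHs]; first exact: eq_definable definable_true.
apply: eq_definable (definable_and (dP a) IHs) => e; split.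
  by move=> [h1 h2] i; rewrite inE => /predU1P[->|/h2].
by move=> h; split=> [|i si]; apply: h; rewrite inE ?eqxx // si orbT.
Qed.

(* Quantifies simultaneously over the variables m, ..., m + n - 1. *)
Lemma definable_exists_block m n P : definable P ->
  definable (fun e => exists x : nat -> R,
    P (fun i => if (m <= i < m + n)%N then x i else e i)).
Proof.
move=> dP; elim: n => [|n IHn].
  apply: eq_definable dP => e; split=> [Pe|[x]].
    exists e; congr P: Pe; apply: functional_extensionality => i.
    by case: ifP.
  by congr P; apply: functional_extensionality => i; rewrite addn0 leqNgt; case: ltnP.
apply: eq_definable (definable_exists (m + n) IHn) => e; split.
  move=> [a [x h]]; exists (update x (m + n) a); congr P: h.
  apply: functional_extensionality => i; rewrite /update addnS ltnS.
  have [->|ne] := eqVneq i (m + n)%N; first by rewrite leq_addr leqnn ltnn.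
  by rewrite [(i <= _)%N]leq_eqVlt (negPf ne).
move=> [x h]; exists (x (m + n)%N), x; congr P: h.
apply: functional_extensionality => i; rewrite /update addnS ltnS.
have [->|ne] := eqVneq i (m + n)%N; first by rewrite leq_addr leqnn ltnn.
by rewrite [(i <= _)%N]leq_eqVlt (negPf ne).
Qed.

Lemma term_definable_var i : term_definable (fun e => e i).
Proof. by exists (GRing.Var R i). Qed.

Lemma term_definable_const (c : R) : term_definable (fun=> c).
Proof. by exists (GRing.Const c). Qed.

Lemma term_definable_add f g :
  term_definable f -> term_definable g -> term_definable (fun e => f e + g e).
Proof. by move=> [t ht] [u hu]; exists (GRing.Add t u) => e /=; rewrite ht hu. Qed.

Lemma term_definable_mul f g :
  term_definable f -> term_definable g -> term_definable (fun e => f e * g e).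
Proof. by move=> [t ht] [u hu]; exists (GRing.Mul t u) => e /=; rewrite ht hu. Qed.

Lemma term_definable_exp n f : term_definable f -> term_definable (fun e => f e ^+ n).
Proof. by move=> [t ht]; exists (GRing.Exp t n) => e /=; rewrite ht. Qed.

Lemma term_definable_sum (I : Type) (r : seq I) (p : pred I) (F : I -> (nat -> R) -> R) :
  (forall i, term_definable (F i)) -> term_definable (fun e => \sum_(i <- r | p i) F i e).
Proof.
move=> dF; elim: r => [|a s IHs].
  by apply: eq_term_definable (term_definable_const 0) => e; rewrite big_nil.
have [pa|pa] := boolP (p a); last first.
  by apply: eq_term_definable IHs => e; rewrite big_cons (negPf pa).
by apply: eq_term_definable (term_definable_add (dF a) IHs) => e; rewrite big_cons pa.
Qed.

Lemma term_definable_prod (I : Type) (r : seq I) (p : pred I) (F : I -> (nat -> R) -> R) :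
  (forall i, term_definable (F i)) -> term_definable (fun e => \prod_(i <- r | p i) F i e).
Proof.
move=> dF; elim: r => [|a s IHs].
  by apply: eq_term_definable (term_definable_const 1) => e; rewrite big_nil.
have [pa|pa] := boolP (p a); last first.
  by apply: eq_term_definable IHs => e; rewrite big_cons (negPf pa).
by apply: eq_term_definable (term_definable_mul (dF a) IHs) => e; rewrite big_cons pa.
Qed.

(** * Definable subsets of the line *)

Definition avoids (s : seq R) (a b : R) := forall c, c \in s -> ~~ (a <= c <= b).

(** This is o-minimality in one variable: tame sets are the finite unions of points and
    intervals. *)
Definition tame (P : R -> Prop) := exists s : seq R,
  forall a b, a <= b -> avoids s a b -> (P a <-> P b).

Lemma eq_tame (P Q : R -> Prop) : (forall a, P a <-> Q a) -> tame P -> tame Q.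
Proof. by move=> PQ [s hs]; exists s => a b ab /(hs _ _ ab); rewrite !PQ. Qed.

Lemma tame_not (P : R -> Prop) : tame P -> tame (fun a => ~ P a).
Proof. by move=> [s hs]; exists s => a b ab /(hs _ _ ab) ->. Qed.

Lemma tame_and (P Q : R -> Prop) : tame P -> tame Q -> tame (fun a => P a /\ Q a).
Proof.
move=> [s hs] [t ht]; exists (s ++ t) => a b ab h.
rewrite (hs a b ab) ?(ht a b ab) // => c hc; apply: h; rewrite mem_cat hc //.
by rewrite orbT.
Qed.

Lemma tame_or (P Q : R -> Prop) : tame P -> tame Q -> tame (fun a => P a \/ Q a).
Proof.
move=> /tame_not hP /tame_not hQ; have := tame_not (tame_and hP hQ).
by apply: eq_tame => a; split=> [/not_and_or[/NNPP|/NNPP]|]; tauto.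
Qed.

Lemma tame_imp (P Q : R -> Prop) : tame P -> tame Q -> tame (fun a => P a -> Q a).
Proof.
by move=> /tame_not hP hQ; apply: eq_tame (tame_or hP hQ) => a; have := classic (P a); tauto.
Qed.

(** The breakpoints are the roots of p: away from them the sign is constant by the intermediate
    value property. *)
Lemma tame_horner_pos (p : {poly R}) : tame (fun a => 0 < p.[a]).
Proof.
have [->|p0] := eqVneq p 0.
  by exists [::] => a b _ _; rewrite !horner0.
exists (rootsR p) => a b ab h; have nr x : a <= x <= b -> p.[x] != 0.
  move=> xab; apply/negP => px; have := h x; rewrite -roots_on_rootsR // in_itv /= rootE px.
  by rewrite xab => /(_ isT).
have stays_neg (q : {poly R}) : (forall x, a <= x <= b -> q.[x] != 0) ->
    q.[a] <= 0 -> q.[b] < 0.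
  move=> nrq qa; rewrite ltNge; apply/negP => qb.
  have [|x xab /eqP px] := poly_ivt ab (_ : q.[a] <= 0 <= q.[b]); first by rewrite qa.
  by have := nrq x xab; rewrite px eqxx.
split=> hp.
  have := stays_neg (- p); rewrite !hornerN oppr_le0 oppr_lt0 => -> //; last exact: ltW.
  by move=> x /nr; rewrite hornerN oppr_eq0.
by rewrite ltNge; apply/negP => /(stays_neg p nr); rewrite ltNge ltW.
Qed.

Lemma tame_horner_zero (p : {poly R}) : tame (fun a => p.[a] == 0).
Proof.
have h := tame_and (tame_not (tame_horner_pos p)) (tame_not (tame_horner_pos (- p))).
apply: eq_tame h => a; rewrite hornerN oppr_gt0; split=> [[/negP h1 /negP h2]|/eqP->].
  by rewrite eq_le leNgt h1 leNgt h2.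
by rewrite ltxx.
Qed.

Lemma rterm_horner (t : GRing.term R) : GRing.rterm t ->
  exists p : {poly R}, forall a, GRing.eval [:: a] t = p.[a].
Proof.
move=> rt; exists (eval_poly [::] (abstrX 0 (to_rterm t))) => a.
by rewrite abstrXP evalE to_rtermE.
Qed.

Lemma tame_qf_eval (F : ord.formula R) :
  ord.qf_form F -> ord.rformula F -> tame (fun a => ord.qf_eval [:: a] F).
Proof.
elim: F => //=.
- by move=> b _ _; exists [::] => a c.
- move=> t u _ /andP[/rterm_horner[p hp] /rterm_horner[q hq]].
  by apply: eq_tame (tame_horner_zero (p - q)) => a; rewrite hp hq !hornerE subr_eq0.
- move=> t u _ /andP[/rterm_horner[p hp] /rterm_horner[q hq]].
  by apply: eq_tame (tame_horner_pos (q - p)) => a; rewrite hp hq !hornerE subr_gt0.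
- move=> t u _ /andP[/rterm_horner[p hp] /rterm_horner[q hq]].
  apply: eq_tame (tame_not (tame_horner_pos (p - q))) => a.
  by rewrite hp hq !hornerE subr_gt0 leNgt; split=> /negP.
- move=> F hF G hG /andP[qF qG] /andP[rF rG].
  by apply: eq_tame (tame_and (hF qF rF) (hG qG rG)) => a; split=> /andP.
- move=> F hF G hG /andP[qF qG] /andP[rF rG].
  by apply: eq_tame (tame_or (hF qF rF) (hG qG rG)) => a; split=> /orP.
- move=> F hF G hG /andP[qF qG] /andP[rF rG].
  by apply: eq_tame (tame_imp (hF qF rF) (hG qG rG)) => a; split=> /implyP.
- by move=> F hF qF rF; apply: eq_tame (tame_not (hF qF rF)) => a; split=> /negP.
Qed.

(** Quantifier elimination leaves a Boolean combination of polynomial sign conditions in one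
    variable. *)
Lemma definable_tame (P : R -> Prop) : definable (fun e => P (e 0%N)) -> tame P.
Proof.
move=> [F hF]; pose G := ord.quantifier_elim (@wproj R) (ord.to_rform F).
have rF := ord.to_rform_rformula F.
have /andP[qG rG] := ord.quantifier_elim_wf (@wf_QE_wproj R) rF.
apply: eq_tame (tame_qf_eval qG rG) => a.
have GP := ord.quantifier_elim_rformP (@wf_QE_wproj R) (@valid_QE_wproj R) [:: a] rF.
by rewrite -(rwP GP) ord.to_rformP hF.
Qed.

(** * Suprema of definable bounded sets *)

Definition supremum (P : R -> Prop) (m : R) :=
  (forall a, P a -> a <= m) /\ (forall b, b < m -> exists2 a, P a & b < a).

(** The supremum is one of the breakpoints. They are examined in turn: either c is the supremum, or
    [a, b] can be narrowed to an interval that misses c and still has its left end in D and its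
    right end outside. *)
Lemma tame_down_closed_sup (D : R -> Prop) (s : seq R) (a b : R) :
  (forall x y, x <= y -> D y -> D x) -> D a -> ~ D b ->
  (forall x y, a <= x -> x <= y -> y <= b -> avoids s x y -> (D x <-> D y)) ->
  exists m, supremum D m.
Proof.
move=> down; elim: s a b => [|c s IHs] a b Da Db tm.
  have ab : a <= b by rewrite leNgt; apply/negP => /ltW /down; tauto.
  by case: Db; apply/(tm a b).
have lt_of x y : D x -> ~ D y -> x < y.
  by move=> Dx Dy; rewrite ltNge; apply/negP => /down h; apply: Dy (h Dx).
have tm' x y : a <= x -> y <= b -> ~~ (x <= c <= y) ->
    forall x' y', x <= x' -> x' <= y' -> y' <= y -> avoids s x' y' -> (D x' <-> D y').
  move=> ax yb cxy x' y' xx' xy' yy' av; apply: tm; rewrite ?(le_trans ax) ?(le_trans yy') //.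
  move=> d; rewrite inE => /predU1P[->|/av //].
  by apply: contra cxy => /andP[h1 h2]; rewrite (le_trans xx') // (le_trans h2).
have [Dc|Dc] := classic (D c).
  have [[x [cx Dx]]|h] := classic (exists x, c < x /\ D x).
    have [ax|/ltW xa] := leP a x.
      by apply: (IHs x b) => //; apply: tm'; rewrite // negb_and -ltNge cx.
    by apply: (IHs a b) => //; apply: tm'; rewrite // negb_and -ltNge (lt_le_trans cx).
  exists c; split=> [x Dx|x xc]; last by exists c.
  by rewrite leNgt; apply/negP => cx; apply: h; exists x.
have [[x [cx Dx]]|h] := classic (exists x, x < c /\ ~ D x).
  have [bx|/ltW xb] := leP b x.
    by apply: (IHs a b) => //; apply: tm'; rewrite // negb_and orbC -ltNge (le_lt_trans bx).
  by apply: (IHs a x) => //; apply: tm'; rewrite // negb_and orbC -ltNge cx.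
exists c; split=> [x Dx|x xc]; first exact/ltW/lt_of.
(* An element of D strictly above x is needed and c is not in D, so the midpoint is taken. *)
have xy : x < (x + c) / 2%:R by lra.
have yc : (x + c) / 2%:R < c by lra.
by exists ((x + c) / 2%:R) => //; apply: NNPP => nD; apply: h; exists ((x + c) / 2%:R).
Qed.

(** The downward closure D of P is definable with one more quantifier and has the same supremum. *)
Lemma definable_sup (P : R -> Prop) (a b : R) :
  definable (fun e => P (e 0%N)) -> P a -> (forall x, P x -> x <= b) ->
  exists m, supremum P m.
Proof.
move=> dP Pa Pb; pose D x := exists2 y, P y & x <= y.
have [s tD] : tame D.
  apply: definable_tame.
  have dQ : definable (fun e => P (e 0%N) /\ e 1%N <= e 0%N).
    exact/definable_and/definable_le/term_definable_var/term_definable_var.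
  have [F hF] := definable_exists 0 dQ.
  (* F binds variable 0 and expects the point in variable 1, whereas tameness reads it in variable
     0; F' copies it over. *)
  pose F' := ord.Exists 1 (ord.And (ord.Equal (GRing.Var R 1) (GRing.Var R 0)) F).
  exists F' => e; rewrite /F' /=; split.
    move=> [x [ex /hF[y]]]; rewrite /update /= => -[Py xy]; exists y => //.
    by move: ex xy; rewrite !nth_set_nth /= => -> .
  move=> [y Py xy]; exists e`_0; split; first by rewrite !nth_set_nth /=.
  by apply/hF; exists y; rewrite /update /= nth_set_nth /=.
have [m [h1 h2]] : exists m, supremum D m.
  (* The bound b may itself belong to P, but b + 1 is outside D. *)
  apply: (@tame_down_closed_sup D s a (b + 1)) => //.
  - by move=> x y xy [z Pz yz]; exists z => //; apply: le_trans yz.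
  - by exists a.
  - by move=> [y /Pb h1 h2]; lra.
  - by move=> x y _ xy _; apply: tD.
exists m; split=> [x Px|x /h2[y [z Pz yz] xy]]; first by apply: h1; exists x.
by exists z => //; apply: lt_le_trans yz.
Qed.

(** Variables 0 and 1 are kept for parameters; the values of x fill the block that starts at 2, in
    the order of the enumeration of V. *)
Lemma definable_exists_fun (V : finType) (Q : R -> R -> (V -> R) -> Prop) :
  definable (fun e => Q (e 0%N) (e 1%N) (fun v => e (2 + enum_rank v)%N)) ->
  definable (fun e => exists x, Q (e 0%N) (e 1%N) x).
Proof.
move=> /(definable_exists_block 2 #|V|); apply: eq_definable => e.
have slot (v : V) : (2 + enum_rank v < 2 + #|V|)%N.
  by rewrite ltn_add2l ltn_ord.
split=> [[x /= Qx]|[x Qx]].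
  exists (fun v => x (2 + enum_rank v)%N); congr Q: Qx => //.
  by apply: functional_extensionality => v /=; rewrite slot.
have [v0|noV] := pickP (@predT V); last first.
  exists e => /=; congr Q: Qx => //; apply: functional_extensionality => v.
  by have := noV v.
exists (fun i => x (nth v0 (enum V) (i - 2))) => /=; congr Q: Qx => //.
apply: functional_extensionality => v /=.
by rewrite slot addKn -enum_val_nth enum_rankK.
Qed.

(** Asking for all substitutions of terms lets the parameter and the coordinates sit in whatever
    variables the enclosing formula uses. *)
Definition definable_family (V : finType) (X : R -> (V -> R) -> Prop) :=
  forall (T : (nat -> R) -> R) (x : V -> (nat -> R) -> R),
  term_definable T -> (forall v, term_definable (x v)) ->
  definable (fun e => X (T e) (fun v => x v e)).

(** * Cluster points of a shrinking definable family *)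

Section Cluster.
Variables (V : finType) (X : R -> (V -> R) -> Prop).
Hypothesis X_definable : definable_family X.
Hypothesis X_mono : forall s t x, s <= t -> X s x -> X t x.
Hypothesis X_bounded : forall t x v, X t x -> 0 <= x v <= 1.

Definition close_on (s : seq V) (x z : V -> R) (t : R) :=
  forall v, v \in s -> x v < z v + t /\ z v < x v + t.

(** These are the b below which x w does not fall once t is small. The supremum of this set is a
    limit inferior of x w, which [cluster_on] takes as the coordinate at w. *)
Lemma definable_lower_bound (z : V -> R) (s : seq V) (w : V) :
  definable (fun e => exists t, 0 < t /\
    ~ exists x, [/\ X t x, close_on s x z t & x w < e 0%N]).
Proof.
have dQ : definable (fun e => 0 < e 1%N /\
    ~ exists x, [/\ X (e 1%N) x, close_on s x z (e 1%N) & x w < e 0%N]).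
  apply: definable_and.
    exact/definable_lt/term_definable_var/term_definable_const.
  apply/definable_not.
  apply: (definable_exists_fun (Q := fun b t x => [/\ X t x, close_on s x z t & x w < b])).
  pose x (v : V) (e : nat -> R) := e (2 + enum_rank v)%N.
  have dx v : term_definable (x v) by apply: term_definable_var.
  have d1 : term_definable (fun e => e 1%N) by apply: term_definable_var.
  have dz v : term_definable (fun=> z v) by apply: term_definable_const.
  have dclose := @definable_all V (mem s) _ (fun v => definable_and
    (definable_lt (dx v) (term_definable_add (dz v) d1))
    (definable_lt (dz v) (term_definable_add (dx v) d1))).
  have d := definable_and (X_definable d1 dx) (definable_and dclose
    (definable_lt (dx w) (term_definable_var 0))).
  by apply: eq_definable d => e; split=> [[? []]|[? ? ?]].
apply: eq_definable (definable_exists 1 dQ) => e.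
by rewrite /update /=; split=> -[t h]; exists t.
Qed.

(** Compactness one coordinate at a time: each new coordinate is the limit inferior over the points
    already close to z on the earlier ones. *)
Lemma cluster_on (s : seq V) : (forall t, 0 < t -> exists x, X t x) ->
  exists z, forall t, 0 < t -> exists2 x, X t x & close_on s x z t.
Proof.
move=> ne; elim: s => [|w s [z IHs]].
  by exists (fun=> 0) => t /ne[x Xx]; exists x.
have [ws|ws] := boolP (w \in s).
  exists z => t /IHs[x Xx h]; exists x => // v; rewrite inE => /predU1P[->|]; exact: h.
pose A b := exists t, 0 < t /\ ~ exists x, [/\ X t x, close_on s x z t & x w < b].
have [|x|m [m1 m2]] := @definable_sup A 0 1 (definable_lower_bound z s w).
- by exists 1; split=> // -[x [/(X_bounded w)]]; lra.
- move=> [t [t0 h]]; rewrite leNgt; apply/negP => x1; apply: h.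
  have [y Xy cy] := IHs t t0; exists y; split => //.
  by have := X_bounded w Xy; lra.
exists (fun v => if v == w then m else z v) => t t0.
have [|b [u [u0 hu]] bm] := m2 (m - t); first by lra.
(* A point of X t' lies in both X t and X u. As m + t' exceeds the supremum, some such point has x w
   < m + t'; the choice of u forces b <= x w, and b > m - t. *)
pose t' := Num.min t u; have t'0 : 0 < t' by rewrite lt_min t0.
have [t't t'u] : t' <= t /\ t' <= u by rewrite !ge_min !lexx orbT.
have h : ~ A (m + t') by move=> /m1; lra.
 have [x [Xx cx xw]] : exists x, [/\ X t' x, close_on s x z t' & x w < m + t'].
  by apply: NNPP => h'; apply: h; exists t'.
have wide r : t' <= r -> close_on s x z r by move=> t'r v /cx; lra.
exists x; first exact: X_mono Xx.
move=> v; rewrite inE; have [-> _|vw /=] := eqVneq v w; last exact: wide.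
split; first by lra.
suff : b <= x w by lra.
rewrite leNgt; apply/negP => xb; apply: hu; exists x; split=> //; last exact: wide.
exact: X_mono Xx.
Qed.

Lemma cluster : (forall t, 0 < t -> exists x, X t x) ->
  exists z, forall t, 0 < t -> exists2 x, X t x & forall v, `|x v - z v| < t.
Proof.
move=> /(cluster_on (enum V))[z hz]; exists z => t /hz[x Xx cx]; exists x => // v.
by have := cx v; rewrite mem_enum ltr_norml => /(_ isT) ?; lra.
Qed.
End Cluster.
End Definability.

(** * Positive eigenvectors *)

(** This is x_v times the entry at v of the tensor applied to x. Multiplying by x_v turns each
    product into one over a whole edge, so no tuples are needed. *)
Definition local_form (R : comNzRingType) (k : nat) (a : R) (H : hypergraph)
    (x : vtx H -> R) (v : vtx H) : R :=
  \sum_(e in edges H | v \in e) (a * x v ^+ k + (1 - a) * \prod_(w in e) x w).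

(** * Lipschitz bounds on the unit box *)

Section Lipschitz.
Variables (R : rcfType) (V : finType).
Implicit Types (x z : V -> R) (g h : (V -> R) -> R).

Definition unit_box x := forall v, 0 <= x v <= 1.

(** One constant is both a bound and a Lipschitz constant for the sup norm; the product rule needs
    the two together. *)
Definition lipschitz_on_box g := exists K : R, [/\ 0 <= K,
  (forall x, unit_box x -> `|g x| <= K) &
  (forall x z (t : R), 0 <= t -> unit_box x -> unit_box z ->
     (forall v, `|x v - z v| <= t) -> `|g x - g z| <= K * t)].

Lemma eq_lipschitz g h : (forall x, g x = h x) -> lipschitz_on_box g -> lipschitz_on_box h.
Proof.
move=> gh [K [K0 Kb KL]]; exists K; split=> // [x|x z t]; rewrite -!gh; first exact: Kb.
exact: KL.
Qed.

Lemma lipschitz_const (c : R) : lipschitz_on_box (fun=> c).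
Proof.
by exists `|c|; split=> // x z t t0 bx bz xz; rewrite subrr normr0 mulr_ge0.
Qed.

Lemma lipschitz_proj v : lipschitz_on_box (fun x => x v).
Proof.
exists 1; split=> // [x bx|x z t t0 bx bz xz]; last by rewrite mul1r.
by have /andP[h1 h2] := bx v; rewrite ger0_norm.
Qed.

Lemma lipschitz_add g h :
  lipschitz_on_box g -> lipschitz_on_box h -> lipschitz_on_box (fun x => g x + h x).
Proof.
move=> [K [K0 Kb KL]] [M [M0 Mb ML]]; exists (K + M); split=> [|x bx|x z t t0 bx bz xz].
- exact: addr_ge0.
- by apply: le_trans (ler_normD _ _) _; rewrite lerD ?Kb ?Mb.
rewrite opprD addrACA mulrDl; apply: le_trans (ler_normD _ _) _.
by rewrite lerD ?KL ?ML.
Qed.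

Lemma lipschitz_mul g h :
  lipschitz_on_box g -> lipschitz_on_box h -> lipschitz_on_box (fun x => g x * h x).
Proof.
move=> [K [K0 Kb KL]] [M [M0 Mb ML]].
have KM0 : 0 <= K * M by rewrite mulr_ge0.
exists (K * M + K * M); split=> [|x bx|x z t t0 bx bz xz].
- exact: addr_ge0.
- by rewrite normrM ler_wpDr // ler_pM // ?Kb ?Mb.
have -> : g x * h x - g z * h z = g x * (h x - h z) + (g x - g z) * h z by ring.
apply: le_trans (ler_normD _ _) _; rewrite !normrM mulrDl lerD //.
  by rewrite -mulrA ler_pM // ?Kb ?ML.
by rewrite mulrAC ler_pM // ?KL ?Mb.
Qed.

Lemma lipschitz_exp n g : lipschitz_on_box g -> lipschitz_on_box (fun x => g x ^+ n).
Proof.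
move=> hg; elim: n => [|n IHn]; first exact: (lipschitz_const 1).
by apply: eq_lipschitz (lipschitz_mul hg IHn) => x; rewrite exprS.
Qed.

Lemma lipschitz_sum (I : Type) (s : seq I) (p : pred I) (F : I -> (V -> R) -> R) :
  (forall i, lipschitz_on_box (F i)) -> lipschitz_on_box (fun x => \sum_(i <- s | p i) F i x).
Proof.
move=> dF; elim: s => [|i s IHs].
  by apply: eq_lipschitz (lipschitz_const 0) => x; rewrite big_nil.
have [pi|pi] := boolP (p i); last first.
  by apply: eq_lipschitz IHs => x; rewrite big_cons (negPf pi).
by apply: eq_lipschitz (lipschitz_add (dF i) IHs) => x; rewrite big_cons pi.
Qed.

Lemma lipschitz_prod (I : Type) (s : seq I) (p : pred I) (F : I -> (V -> R) -> R) :
  (forall i, lipschitz_on_box (F i)) -> lipschitz_on_box (fun x => \prod_(i <- s | p i) F i x).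
Proof.
move=> dF; elim: s => [|i s IHs].
  by apply: eq_lipschitz (lipschitz_const 1) => x; rewrite big_nil.
have [pi|pi] := boolP (p i); last first.
  by apply: eq_lipschitz IHs => x; rewrite big_cons (negPf pi).
by apply: eq_lipschitz (lipschitz_mul (dF i) IHs) => x; rewrite big_cons pi.
Qed.
End Lipschitz.

(** * Supersolutions and a Harnack inequality *)

Section LocalForm.
Variables (R : realFieldType) (k : nat) (a : R) (H : hypergraph).
Hypotheses (H_unif : uniform k H) (a_ge0 : 0 <= a) (a_lt1 : a < 1).
Local Notation F := (local_form k a).
Implicit Types (x y z : vtx H -> R) (v w : vtx H).

Lemma local_form_scale c x v : F (fun w => c * x w) v = c ^+ k * F x v.
Proof.
rewrite /local_form mulr_sumr; apply: eq_bigr => e /andP[/H_unif ek _].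
by rewrite big_split /= prodr_const ek exprMn; ring.
Qed.

Lemma edge_term_ge0 x v (e : {set vtx H}) : (forall w, 0 <= x w) ->
  0 <= a * x v ^+ k + (1 - a) * \prod_(w in e) x w.
Proof.
move=> x0; rewrite addr_ge0 ?mulr_ge0 ?exprn_ge0 ?prodr_ge0 // subr_ge0; exact: ltW.
Qed.

Lemma edge_term_le_local_form x v (e : {set vtx H}) : (forall w, 0 <= x w) ->
  e \in edges H -> v \in e -> a * x v ^+ k + (1 - a) * \prod_(w in e) x w <= F x v.
Proof.
move=> x0 eE ve; rewrite /local_form (bigD1 e) ?eE //= ler_wpDr //.
by apply: sumr_ge0 => e' _; apply: edge_term_ge0.
Qed.

Lemma local_form_ge0 x v : (forall w, 0 <= x w) -> 0 <= F x v.
Proof. by move=> x0; apply: sumr_ge0 => e _; apply: edge_term_ge0. Qed.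

Lemma local_form_gt0 x v (e : {set vtx H}) : (forall w, 0 < x w) ->
  e \in edges H -> v \in e -> a * x v ^+ k < F x v.
Proof.
move=> x0 eE ve; apply: lt_le_trans (edge_term_le_local_form _ eE ve).
  by rewrite ltrDl mulr_gt0 ?subr_gt0 // prodr_gt0.
by move=> w; apply: ltW.
Qed.

(** The infimum of the r that admit such an x is the Collatz-Wielandt value, the infimum over
    positive x of the maximum over v of F x v / x_v^k. *)
Definition supersolution r x :=
  (forall v, 0 < x v) /\ forall v, F x v <= r * x v ^+ k.

(** The inequality is read at the vertex l of e where x is least: there the edge product is at least
    x_w x_l^(k-1), while F x l <= B x_l^k. Finally x_l <= x_v. *)
Lemma supersolution_edge_ratio B x v w (e : {set vtx H}) : (0 < k)%N ->
  supersolution B x -> e \in edges H -> v \in e -> w \in e -> (1 - a) * x w <= B * x v.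
Proof.
move=> k0 [x0 xB] eE ve we.
have [l le lmin] : exists2 l, l \in e & forall j, j \in e -> x l <= x j.
  by case: (arg_minP x ve) => l le lmin; exists l.
have xge0 j : 0 <= x j by apply: ltW.
have a1 : 0 <= 1 - a by rewrite subr_ge0 ltW.
have B0 : 0 <= B.
  have := le_trans (local_form_ge0 v xge0) (xB v); rewrite pmulr_lge0 //.
  by rewrite exprn_gt0.
suff h : (1 - a) * x w <= B * x l by rewrite (le_trans h) // ler_wpM2l // lmin.
have pw : 0 < x l ^+ k.-1 by rewrite exprn_gt0.
rewrite -(ler_pM2r pw) -[leRHS]mulrA -exprS prednK //.
have := le_trans (edge_term_le_local_form xge0 eE le) (xB l).
apply: le_trans; rewrite (bigD1 w) //= mulrA.
apply: le_trans (_ : (1 - a) * x w * \prod_(i in e | i != w) x i <= _); last first.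
  by rewrite ler_wpDl // mulr_ge0 // exprn_ge0.
rewrite ler_wpM2l ?mulr_ge0 //.
have -> : x l ^+ k.-1 = \prod_(i in e | i != w) x l.
  rewrite prodr_const; congr (_ ^+ _); have := cardD1 w e.
  by rewrite we (H_unif eE) /= add1n => ->; apply: eq_card => i; rewrite !inE andbC.
by apply: ler_prod => i /andP[ie _]; rewrite xge0 lmin.
Qed.

(** A Harnack inequality: the edge estimate is iterated along a path without repeated vertices. The
    factor is at most 1, so the exponent may be raised to the number of vertices, making the bound
    uniform in x, v and w. *)
Lemma supersolution_ratio B x v w : (0 < k)%N -> 1 <= B -> connected H ->
  supersolution B x -> ((1 - a) / B) ^+ #|vtx H| * x w <= x v.
Proof.
move=> k0 B1 conn xB; have B0 : 0 < B by lra.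
set c := (1 - a) / B.
have c0 : 0 <= c by rewrite divr_ge0 ?subr_ge0 ?ltW.
have c1 : c <= 1 by rewrite ler_pdivrMr // mul1r (le_trans _ B1) // gerBl.
have /connectP[p] := conn v w; case/shortenP => q vq uq _ wE.
have step : c ^+ size q * x w <= x v.
  rewrite wE; elim: q v vq {uq wE} => [|j q IHq] v /=; first by rewrite mul1r.
  case/andP=> /exists_inP[e eE /andP[ve je]] /IHq h.
  rewrite exprS -mulrA; apply: le_trans (ler_wpM2l c0 h) _.
  rewrite /c mulrAC ler_pdivrMr // [x v * B]mulrC.
  exact: supersolution_edge_ratio xB eE ve je.
apply: le_trans step; rewrite ler_wpM2r //; first exact/ltW/(proj1 xB).
rewrite ler_wiXn2l //; have := card_uniqP uq => /= h.
by apply: leq_trans (max_card (mem (v :: q))); rewrite h.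
Qed.
End LocalForm.

(** * Existence of a positive eigenvector and its extremality *)

Section Perron.
Variables (R : rcfType) (k : nat) (a : R) (H : hypergraph) (v0 : vtx H).
Hypotheses (k_ge2 : (2 <= k)%N) (H_unif : uniform k H) (H_conn : connected H).
Hypotheses (a_ge0 : 0 <= a) (a_lt1 : a < 1).
Local Notation V := (vtx H).
Local Notation F := (local_form k a).
Implicit Types (x y z : V -> R) (v w : V).

Let k_gt0 : (0 < k)%N. Proof. exact: ltnW. Qed.

Lemma term_definable_local_form (x : V -> (nat -> R) -> R) v :
  (forall w, term_definable (x w)) -> term_definable (fun e => F (fun w => x w e) v).
Proof.
move=> dx; apply: term_definable_sum => e; apply: term_definable_add.
  by apply: term_definable_mul; [exact: term_definable_const|exact: term_definable_exp].
apply: term_definable_mul; first exact: term_definable_const.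
exact: term_definable_prod.
Qed.

Lemma lipschitz_local_form v : lipschitz_on_box (fun x => F x v).
Proof.
apply: lipschitz_sum => e; apply: lipschitz_add.
  by apply: lipschitz_mul; [exact: lipschitz_const|exact/lipschitz_exp/lipschitz_proj].
apply: lipschitz_mul; first exact: lipschitz_const.
by apply: lipschitz_prod => w; apply: lipschitz_proj.
Qed.

Lemma lipschitz_defect r v : lipschitz_on_box (fun x => F x v - r * x v ^+ k).
Proof.
have h := lipschitz_add (lipschitz_local_form v) (lipschitz_mul (lipschitz_const _ (- r)) (lipschitz_exp k (lipschitz_proj R v))).
by apply: eq_lipschitz h => x; rewrite mulNr.
Qed.

Lemma supersolution_normalize r x : supersolution k a r x ->
  exists y, [/\ supersolution k a r y, forall v, y v <= 1 & exists w, y w = 1].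
Proof.
move=> [x0 xr]; case: (arg_maxP x (erefl true : predT v0)) => w _ wmax.
have w0 := x0 w; exists (fun v => (x w)^-1 * x v); split; last by exists w; rewrite mulVf ?gt_eqF.
  split=> v; first by rewrite mulr_gt0 ?invr_gt0.
  rewrite local_form_scale // exprMn mulrCA ler_wpM2l ?xr // exprn_ge0 // invr_ge0.
  exact: ltW.
by move=> v; rewrite mulrC ler_pdivrMr // mul1r; apply: wmax.
Qed.

Lemma supersolution_weaken r s x : r <= s -> supersolution k a r x -> supersolution k a s x.
Proof.
move=> rs [x0 xr]; split=> // v; apply: le_trans (xr v) _.
by rewrite ler_wpM2r // exprn_ge0 // ltW.
Qed.

Definition optimal r :=
  (forall s x, supersolution k a s x -> r <= s) /\
  (forall t : R, 0 < t -> exists s x, s < r + t /\ supersolution k a s x).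

Lemma optimal_exists : exists r, optimal r.
Proof.
(* The sign is reversed to obtain an infimum from [definable_sup]. The bounds come from the constant
   vector 1 and from F >= 0. *)
pose P s := exists x, supersolution k a (- s) x.
have dP : definable (fun e => P (e 0%N)).
  apply: (definable_exists_fun (Q := fun s _ x => supersolution k a (- s) x)).
  pose x (v : V) (e : nat -> R) := e (2 + enum_rank v)%N.
  have dx v : term_definable (x v) by apply: term_definable_var.
  have ds : term_definable (fun e : nat -> R => - e 0%N).
    apply: eq_term_definable (term_definable_mul (term_definable_const (-1)) (term_definable_var R 0)).
    by move=> e; rewrite mulN1r.
  have d := definable_and
    (@definable_all _ V predT _ (fun v => definable_lt (term_definable_const 0) (dx v)))
    (@definable_all _ V predT _ (fun v => definable_le (term_definable_local_form v dx)
       (term_definable_mul ds (term_definable_exp k (dx v))))).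
  by apply: eq_definable d => e; split=> -[h1 h2]; split=> v; [apply: h1|apply: h2|move=> _; apply: h1|move=> _; apply: h2].
pose B : R := \sum_(v : V) F (fun=> 1) v.
have PB : P (- B).
  exists (fun=> 1); split=> // v; rewrite opprK expr1n mulr1 /B (bigD1 v) //= lerDl.
  by apply: sumr_ge0 => w _; apply: local_form_ge0.
have P0 s : P s -> s <= 0.
  move=> [x [x0 xs]]; rewrite -oppr_ge0 -(pmulr_lge0 _ (exprn_gt0 k (x0 v0))).
  by apply: le_trans (xs v0); apply: local_form_ge0 => // w; apply: ltW.
have [m [m1 m2]] := definable_sup dP PB P0.
exists (- m); split=> [s x sx|t t0].
  by rewrite lerNl; apply: m1; exists x; rewrite opprK.
have [|s [x sx] ms] := m2 (m - t); first by lra.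
by exists (- s), x; split=> //; lra.
Qed.

(** Normalized supersolutions for r + t have their values in a fixed interval [d, 1] with d > 0, so
    they cluster at some positive z as t shrinks, and the inequality passes to z by Lipschitz
    continuity. *)
Lemma optimal_attained r : optimal r ->
  exists x, supersolution k a r x /\ forall v, x v <= 1.
Proof.
move=> [rmin rinf].
have r0 : 0 <= r.
  rewrite leNgt; apply/negP => r0; have [|s [x [sr [x0 xs]]]] := rinf (- r); first by lra.
  have F0 : 0 <= F x v0 by apply: local_form_ge0 => // w; apply: ltW.
  have := le_trans F0 (xs v0).
  by rewrite pmulr_lge0 ?exprn_gt0 //; lra.
(* This is the Harnack constant for B = r + 1, valid for all supersolutions with t <= 1. *)
pose d := ((1 - a) / (r + 1)) ^+ #|V|.
have d0 : 0 < d by rewrite exprn_gt0 // divr_gt0 ?subr_gt0 //; lra.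
pose X t x := (forall v, d <= x v <= 1) /\ forall v, F x v <= (r + t) * x v ^+ k.
have dX : definable_family X.
  move=> T x dT dx.
  have dle (u w : (nat -> R) -> R) := @definable_le R u w.
  have d1 := term_definable_add (term_definable_const r) dT.
  have d2 := definable_and
    (@definable_all _ V predT _ (fun v => definable_and
       (definable_le (term_definable_const d) (dx v))
       (definable_le (dx v) (term_definable_const 1))))
    (@definable_all _ V predT _ (fun v => definable_le (term_definable_local_form v dx)
       (term_definable_mul d1 (term_definable_exp k (dx v))))).
  apply: eq_definable d2 => e; split=> -[h1 h2]; split=> v.
  - by apply/andP/h1.
  - exact: h2.
  - by move=> _; apply/andP/h1.
  - by move=> _; apply: h2.
have X0 t x v : X t x -> 0 <= x v <= 1.
  by move=> [/(_ v)/andP[h ->] _]; rewrite andbT (le_trans (ltW d0)).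
have Xmono s t x : s <= t -> X s x -> X t x.
  move=> st [h1 h2]; split=> // v; apply: le_trans (h2 v) _.
  rewrite ler_wpM2r ?lerD2l // exprn_ge0 //; by have /andP[] := X0 s x v (conj h1 h2).
have Xne t : 0 < t -> exists x, X t x.
  move=> t0; have [|s [x [sr sx]]] := rinf (Num.min t 1); first by rewrite lt_min t0 ltr01.
  have [y [sy y1 [w yw]]] := supersolution_normalize sx.
  have [st s1] : s <= r + t /\ s <= r + 1.
    by move: sr; rewrite -ltrBlDl lt_min => /andP[]; lra.
  exists y; split=> v; last by have [_ ->] := supersolution_weaken st sy.
  rewrite y1 andbT -[d]mulr1 -yw; apply: (supersolution_ratio H_unif) => //; first by lra.
  exact: supersolution_weaken sy.
have [z hz] := cluster dX Xmono X0 Xne.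
have zbox v : d <= z v <= 1.
  have near t : 0 < t -> d - t < z v /\ z v < 1 + t.
    by move=> /hz[x [/(_ v) hx _] /(_ v)]; rewrite ltr_norml; lra.
  apply/andP; split; rewrite leNgt; apply/negP => h.
    by have [] := near (d - z v); lra.
  by have [] := near (z v - 1); lra.
exists z; split; last by move=> v; have /andP[] := zbox v.
split=> v; first by have /andP[+ _] := zbox v; apply: lt_le_trans.
have [K [K0 _ KL]] := lipschitz_defect r v.
rewrite -subr_le0 leNgt; apply/negP => G0; set G := _ - _ in G0.
(* The defect at x is at most t and that at z differs by at most K t, so G <= (1 + K) t < G. *)
pose t := G / (2%:R + K); have K2 : 0 < 2%:R + K by lra.
have t0 : 0 < t by rewrite divr_gt0.
have Gt : G = t * (2%:R + K) by rewrite divfK ?gt_eqF.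
have [x xX xz] := hz t t0; have [xd xF] := xX.
have bx : unit_box x by move=> w; apply: X0 xX.
have bz : unit_box z by move=> w; have := zbox w; lra.
have := KL x z t (ltW t0) bx bz (fun w => ltW (xz w)).
have xk1 : x v ^+ k <= 1 by rewrite exprn_ile1 //; have := bx v; lra.
have := xF v; rewrite -/G ler_norml mulrDl => h1 /andP[h2 _].
have h3 : t * x v ^+ k <= t by rewrite ler_piMr // ltW.
by nra.
Qed.

(* Lowering x at a strict vertex i keeps i strict and makes all its neighbours strict. *)
Lemma strict_spread r x i : supersolution k a r x -> (forall v, x v <= 1) ->
  F x i < r * x i ^+ k ->
  exists y, [/\ supersolution k a r y, forall v, y v <= 1,
    forall v, F x v < r * x v ^+ k -> F y v < r * y v ^+ k &
    forall v, adjrel H i v -> F y v < r * y v ^+ k].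
Proof.
move=> [x0 xr] x1 istrict.
have [K [K0 _ KL]] := lipschitz_defect r i.
pose G := r * x i ^+ k - F x i; have G0 : 0 < G by rewrite subr_gt0.
(* The first bound keeps y positive at i; the second makes the defect at i change by less than G, so
   i stays strict. *)
pose t := Num.min (x i / 2%:R) (G / (K + 1)).
have K1 : 0 < K + 1 by lra.
have t0 : 0 < t by rewrite lt_min !divr_gt0.
have tx : t < x i.
  by apply: le_lt_trans (_ : x i / 2%:R < _); [rewrite ge_min lexx|have := x0 i; lra].
have Kt : K * t < G.
  have : t <= G / (K + 1) by rewrite ge_min lexx orbT.
  by rewrite ler_pdivlMr //; nra.
pose y w := if w == i then x i - t else x w.
have yi : y i = x i - t by rewrite /y eqxx.
have yx w : y w <= x w by rewrite /y; case: eqP => [->|]; lra.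
have y0 w : 0 < y w by rewrite /y; case: eqP => // _; lra.
have yk v : v != i -> y v ^+ k = x v ^+ k by move=> vi; rewrite /y (negPf vi).
have Fmono v (e : {set V}) : v != i -> a * y v ^+ k + (1 - a) * \prod_(w in e) y w <=
    a * x v ^+ k + (1 - a) * \prod_(w in e) x w.
  move=> vi; rewrite yk // lerD2l; apply: ler_wpM2l; first by rewrite subr_ge0 ltW.
  by apply: ler_prod => w _; rewrite yx ltW.
have y_strict : F y i < r * y i ^+ k.
  have bx : unit_box x by move=> w; rewrite x1 ltW.
  have b_y : unit_box y by move=> w; rewrite (le_trans (yx w)) ?x1 // ltW.
  have xy w : `|y w - x w| <= t.
    rewrite /y; case: eqP => [->|]; last by rewrite subrr normr0 ltW.
    by rewrite addrAC subrr sub0r normrN gtr0_norm.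
  have := KL y x t (ltW t0) b_y bx xy; rewrite ler_norml; rewrite /G in Kt.
  by move=> /andP[_ h]; lra.
have yF v : v != i -> F y v <= F x v.
  by move=> vi; apply: ler_sum => e _; apply: Fmono.
exists y; split=> [|v|v xs|v].
- split=> // v; have [->|vi] := eqVneq v i; first exact: ltW.
  by rewrite yk // (le_trans (yF v vi)).
- exact: le_trans (yx v) (x1 v).
- have [->//|vi] := eqVneq v i.
  by rewrite yk // (le_lt_trans (yF v vi)).
have [->//|vi] := eqVneq v i; case/exists_inP => e eE /andP[ie ve].
rewrite yk //; apply: lt_le_trans (xr v).
rewrite /local_form (bigD1 e) ?eE // [ltRHS](bigD1 e) ?eE //=.
apply: ltr_leD; last by apply: ler_sum => e' _; apply: Fmono.
rewrite yk // ltrD2l ltr_pM2l ?subr_gt0 // (bigD1 i) // [ltRHS](bigD1 i) //= yi.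
have -> : \prod_(w in e | w != i) y w = \prod_(w in e | w != i) x w.
  by apply: eq_bigr => w /andP[_ /negPf wi]; rewrite /y wi.
by rewrite ltr_pM2r ?gtrDl ?oppr_lt0 // prodr_gt0.
Qed.

(** Induction on the number of vertices that are not strict. By connectedness some strict vertex has
    a non-strict neighbour, which [strict_spread] makes strict. *)
Lemma strict_everywhere r x i : supersolution k a r x -> (forall v, x v <= 1) ->
  F x i < r * x i ^+ k ->
  exists y, supersolution k a r y /\ forall v, F y v < r * y v ^+ k.
Proof.
pose S x := [set v | F x v < r * x v ^+ k].
have [n] := ubnP (#|V| - #|S x|); elim: n x i => // n IHn x i sn xr x1 istrict.
have [/forallP h|] := boolP [forall v, v \in S x].
  by exists x; split=> // v; have := h v; rewrite inE.
case/forallPn => w wS.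
have [j [l [jS lS jl]]] : exists j l, [/\ j \in S x, l \notin S x & adjrel H j l].
  apply: NNPP => h; have cl : closed (adjrel H) (S x).
    have sym p q : adjrel H p q -> adjrel H q p.
      by case/exists_inP => e eE /andP[pe qe]; apply/exists_inP; exists e; rewrite ?qe.
    have step p q : adjrel H p q -> p \in S x -> q \in S x.
      by move=> pq pS; apply: contraT => qS; case: h; exists p, q.
    by move=> p q pq; apply/idP/idP; apply: step => //; apply: sym.
  have := closed_connect cl (H_conn i w); rewrite (negPf wS) inE istrict //.
have jstrict : F x j < r * x j ^+ k by rewrite inE in jS.
have [y [yr y1 yS yadj]] := strict_spread xr x1 jstrict.
apply: (IHn y i) => //; last exact: yS.
have lt_card : (#|S x| < #|S y|)%N.
  apply: proper_card; apply/properP; split.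
    by apply/subsetP => v; rewrite !inE; apply: yS.
  by exists l => //; rewrite inE; apply: yadj.
apply: leq_trans (_ : (#|V| - #|S x| <= n)%N) => //.
apply: ltn_sub2l => //; apply: leq_trans lt_card (max_card _).
Qed.

(** If the minimizer were strict somewhere, another supersolution y would be strict everywhere, and
    the largest ratio F y w / y_w^k would be an admissible value below the optimum. *)
Lemma perron : exists r x, (forall v, 0 < x v) /\ forall v, F x v = r * x v ^+ k.
Proof.
have [r r_opt] := optimal_exists; have [x [xr x1]] := optimal_attained r_opt.
exists r, x; split=> [|v]; first by case: xr.
apply/eqP; rewrite eq_le (proj2 xr) leNgt; apply/negP => vstrict.
have [y [[y0 _] ystrict]] := strict_everywhere xr x1 vstrict.
have [w _ wmax] := arg_maxP (fun w => F y w / y w ^+ k) (erefl true : predT v0).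
have : r <= F y w / y w ^+ k.
  apply: (proj1 r_opt _ y); split=> // j.
  by rewrite -ler_pdivrMr ?exprn_gt0 //; apply: wmax.
by rewrite leNgt ltr_pdivrMr ?exprn_gt0 // ystrict.
Qed.

(* By AM-GM on each edge applied to the ratios y / x. *)
Lemma rayleigh_le r x y : (forall v, 0 < x v) -> (forall v, F x v = r * x v ^+ k) ->
  (forall v, 0 <= y v) -> \sum_v F y v <= r * \sum_v y v ^+ k.
Proof.
move=> x0 xr y0; pose q v := (y v / x v) ^+ k.
have q0 v : 0 <= q v by rewrite exprn_ge0 // divr_ge0 // ltW.
have yq v : y v ^+ k = q v * x v ^+ k.
  by rewrite -exprMn divfK // gt_eqF.
have agm (e : {set V}) : e \in edges H -> k%:R * \prod_(w in e) y w <=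
    \prod_(w in e) x w * \sum_(w in e) q w.
  move=> eE; have ek := H_unif eE.
  have -> : \prod_(w in e) y w = \prod_(w in e) x w * \prod_(w in e) (y w / x w).
    by rewrite -big_split; apply: eq_bigr => w _ /=; rewrite mulrC divfK // gt_eqF.
  rewrite mulrCA ler_wpM2l ?prodr_ge0 // => [w _|]; first exact: ltW.
  rewrite mulrC -ler_pdivlMr ?ltr0n // -(ler_pXn2r k_gt0) ?nnegrE.
  - by rewrite -prodrXl; have [+ _] := @leif_AGM R V (mem e) q (fun v _ => q0 v); rewrite ek.
  - by apply: prodr_ge0 => w _; rewrite divr_ge0 // ltW.
  - by rewrite divr_ge0 // sumr_ge0.
have swap (f : {set V} -> V -> R) : \sum_v \sum_(e in edges H | v \in e) f e v =
    \sum_(e in edges H) \sum_(v in e) f e v.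
  rewrite (exchange_big_dep (mem (edges H))) /=; last by move=> v e _ /andP[].
  by apply: eq_bigr => e eE; apply: eq_bigl => v; rewrite eE.
(* The eigenequation replaces r y_v^k by q_v F x v, so that both sides become sums over edges and
   can be compared edge by edge. *)
rewrite mulr_sumr; under [leRHS]eq_bigr => v _ do rewrite yq mulrCA -xr mulr_sumr.
rewrite /local_form !swap; apply: ler_sum => e eE.
under [leRHS]eq_bigr => v _ do rewrite mulrDr mulrCA -yq mulrA.
rewrite !big_split lerD2l /= sumr_const (H_unif eE) -mulr_suml -mulr_natl.
rewrite -mulr_suml mulrCA [leRHS]mulrAC [leRHS]mulrC.
apply: ler_wpM2l; first by rewrite subr_ge0 ltW.
by rewrite [leRHS]mulrC; apply: agm.
Qed.
End Perron.

(** * Pendant paths *)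

Section Attach.
Variables (n : nat) (H : hypergraph) (u : vtx H) (s : nat).
Local Notation k := n.+2.
Local Notation HA := (attach k H u s).
Local Notation pend := (pendant_edge k H u s).
Local Notation lft := (lift_edge (vtx H) ('I_s * 'I_k.-1)%type).

(* The vertex w_m of the pendant path; the value at m > s is junk. *)
Definition joint (m : nat) : vtx HA :=
  if m is m'.+1 then
    if (insub m' : option 'I_s) is Some i then inr (i, ord0) else inl u
  else inl u.

Lemma joint_succ (i : 'I_s) : joint i.+1 = inr (i, ord0).
Proof. by rewrite /joint valK. Qed.

Lemma joint_ord_ne (i : 'I_s) (j : 'I_n.+1) : joint i != inr (i, j).
Proof.
case: i => -[|m] ms //=; rewrite insubT ?(ltnW ms) //= => ?.
by apply/eqP => -[/eqP]; rewrite ltn_eqF.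
Qed.

Lemma pendant_edgeE (i : 'I_s) :
  pend i = joint i |: [set inr (i, j) | j : 'I_n.+1].
Proof.
apply/setP => -[v|[i' j]]; rewrite !inE /=.
  have -> : (inl v \in [set inr (i, j) | j : 'I_n.+1]) = false.
    by apply/negbTE/imsetP => -[].
  rewrite orbF; case: i => -[|m] ms /=; first by rewrite andbT.
  by rewrite insubT ?(ltnW ms) //= => ?; rewrite andbF.
have -> : ((inr (i', j) : vtx HA) \in [set inr (i, j) | j : 'I_n.+1]) = (i' == i).
  by apply/idP/idP => [/imsetP[j' _ [-> _]]|/eqP->] //; apply/imsetP; exists j.
rewrite orbC -val_eqE; congr (_ || _).
case: i => -[|m] ms /=; first by rewrite ?andbF .
by rewrite insubT ?(ltnW ms).
Qed.

Lemma inr_mem_pendant (i i' : 'I_s) (j : 'I_n.+1) :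
  (inr (i, j) \in pend i') = (i == i') || ((val i).+1 == val i') && (j == ord0).
Proof. by rewrite inE. Qed.

Lemma inl_mem_pendant (v : vtx H) (i : 'I_s) : (inl v \in pend i) = (v == u) && (val i == 0%N).
Proof. by rewrite inE. Qed.

Lemma inl_mem_lift (v : vtx H) (e : {set vtx H}) : (inl v \in lft e) = (v \in e).
Proof. by rewrite mem_imset //; apply: inl_inj. Qed.

Lemma inr_mem_lift y (e : {set vtx H}) : (inr y \in lft e) = false.
Proof. by apply/negbTE/imsetP => -[]. Qed.

Lemma pendant_edge_inj : injective pend.
Proof.
move=> i i' /setP E; have := E (inr (i, ord0)); have := E (inr (i', ord0)).
rewrite !inr_mem_pendant !eqxx /= !andbT => h1 h2; apply/eqP.
by rewrite -val_eqE; move: h1 h2; rewrite -!val_eqE /=; lia.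
Qed.

Lemma lift_edge_inj : injective lft.
Proof. by apply: imset_inj; apply: inl_inj. Qed.

Lemma edges_attach_sum (A : nmodType) (x : vtx HA) (f : {set vtx HA} -> A) :
  \sum_(e in edges HA | x \in e) f e =
  \sum_(e in edges H | x \in lft e) f (lft e) + \sum_(i < s | x \in pend i) f (pend i).
Proof.
rewrite big_mkcondr [X in _ = X + _]big_mkcondr [X in _ = _ + X]big_mkcond.
have disj : [disjoint [set lft e | e in edges H] & [set pend i | i : 'I_s]].
  apply/pred0P => e /=; apply/negbTE/andP => -[/imsetP[e' _ ->]] /imsetP[i _ /setP].
  by move=> /(_ (inr (i, ord0))); rewrite inr_mem_lift inr_mem_pendant eqxx.
under eq_bigl => e do rewrite in_setU.
rewrite (bigU _ _ _ disj) big_imset /=; last by move=> ? ? _ _; apply: lift_edge_inj.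
rewrite big_imset /=; last by move=> ? ? _ _; apply: pendant_edge_inj.
by congr (_ + _); apply: eq_bigl => i; rewrite inE.
Qed.

Lemma card_pendant_edge (i : 'I_s) : #|pend i| = k.
Proof.
rewrite pendant_edgeE cardsU1 card_imset ?card_ord; last by move=> j j' [].
case: imsetP => [[j _ /eqP]|//]; by rewrite (negPf (joint_ord_ne i j)).
Qed.

Lemma uniform_attach : uniform k H -> uniform k HA.
Proof.
move=> Hk e /setUP[/imsetP[e' /Hk e'k ->]|/imsetP[i _ ->]]; last exact: card_pendant_edge.
by rewrite card_imset //; apply: inl_inj.
Qed.

Lemma pendant_edge_mem (i : 'I_s) : pend i \in edges HA.
Proof. by apply/setUP; right; apply: imset_f. Qed.

Lemma lift_edge_mem (e : {set vtx H}) : e \in edges H -> lft e \in edges HA.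
Proof. by move=> eE; apply/setUP; left; apply: imset_f. Qed.

Lemma adjrel_sym (K : hypergraph) (x y : vtx K) : adjrel K x y = adjrel K y x.
Proof.
by apply/exists_inP/exists_inP => -[e eE /andP[h1 h2]]; exists e; rewrite ?h2.
Qed.

Lemma connected_attach : connected H -> connected HA.
Proof.
move=> Hconn; have csym : connect_sym (adjrel HA).
  by apply: sym_connect_sym => x y; rewrite adjrel_sym.
suff to_u x : connect (adjrel HA) (inl u) x.
  by move=> x y; apply: connect_trans (to_u y); rewrite csym.
have joint_u m : (m <= s)%N -> connect (adjrel HA) (inl u) (joint m).
  elim: m => [|m IHm] ms //; apply: connect_trans (IHm (ltnW ms)) _.
  rewrite (joint_succ (Ordinal ms)); apply: connect1; apply/exists_inP.
  exists (pend (Ordinal ms)); first exact: pendant_edge_mem.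
  by rewrite pendant_edgeE !inE eqxx /= imset_f ?orbT.
case: x => [v|[i j]].
  have /connectP[p] := Hconn u v.
  suff h z : path (adjrel H) z p -> v = last z p -> connect (adjrel HA) (inl z) (inl v) by exact: h.
  elim: p z => [|w p IHp] z /=; first by move=> _ ->.
  case/andP=> /exists_inP[e eE /andP[ze we]] pp vE.
  apply: connect_trans (IHp w pp vE); apply: connect1; apply/exists_inP.
  by exists (lft e); rewrite ?lift_edge_mem ?inl_mem_lift ?ze.
apply: connect_trans (joint_u i (ltnW (ltn_ord i))) _; apply: connect1; apply/exists_inP.
exists (pend i); first exact: pendant_edge_mem.
by rewrite pendant_edgeE !inE eqxx /= imset_f ?orbT.
Qed.

Section Form.
Variables (R : comNzRingType) (a : R) (x : vtx HA -> R).
Local Notation F := (local_form k a).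

Definition pendant_prod (i : 'I_s) := \prod_(w in pend i) x w.

Lemma pendant_prodE (i : 'I_s) :
  pendant_prod i = x (joint i) * \prod_(j < n.+1) x (inr (i, j)).
Proof.
rewrite /pendant_prod pendant_edgeE big_setU1 /=; last first.
  by apply/imsetP => -[j _ /eqP]; rewrite (negPf (joint_ord_ne i j)).
by rewrite big_imset //= => j j' _ _ [].
Qed.

(** The sum over i with value 0 is the first pendant edge when s > 0 and empty when s = 0, which
    covers both cases at once. *)
Lemma local_form_attach_inl v :
  F x (inl v) = F (x \o inl) v +
    (if v == u then \sum_(i < s | val i == 0%N) (a * x (inl u) ^+ k + (1 - a) * pendant_prod i) else 0).
Proof.
rewrite /local_form edges_attach_sum; congr (_ + _).
  rewrite (eq_bigl (fun e => (e \in edges H) && (v \in e))) => [|e]; last by rewrite inl_mem_lift.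
  apply: eq_bigr => e _; congr (_ + _ * _).
  by rewrite big_imset //= => ? ? _ _ [].
rewrite (eq_bigl _ _ (inl_mem_pendant v)); case: eqP => [->//|_] /=.
by rewrite big_pred0.
Qed.

Lemma local_form_attach_inr (i : 'I_s) (j : 'I_n.+1) :
  F x (inr (i, j)) = a * x (inr (i, j)) ^+ k + (1 - a) * pendant_prod i +
    (if j == ord0 then
       \sum_(i' < s | val i' == i.+1) (a * x (inr (i, j)) ^+ k + (1 - a) * pendant_prod i')
     else 0).
Proof.
rewrite /local_form edges_attach_sum big1 ?add0r; last first.
  by move=> e /andP[_]; rewrite inr_mem_lift.
rewrite (eq_bigl _ _ (inr_mem_pendant i ^~ j)) (bigD1 i) ?eqxx //=; congr (_ + _).
case: eqP => [->|_] /=; last first.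
  by rewrite big_pred0 // => i'; rewrite andbF orbF eq_sym andbN.
apply: eq_bigl => i'; rewrite andbT -!val_eqE /=; lia.
Qed.
End Form.
End Attach.
Arguments joint {n H} u {s} m.

(** * The three-term recurrence *)

Section Chain.
Variable R : rcfType.
Implicit Types (a b d l z t : R) (m : nat).

(** A Chebyshev-type sequence, indexed from the free end of the path: index 1 is the end and index 0
    a fictitious joint beyond it. With z = - a / d the end joint, of degree 1, obeys the same
    recurrence as the inner joints. *)
Fixpoint chain_pair z t m : R * R :=
  if m is m'.+1 then let p := chain_pair z t m' in (p.2, t * p.2 - p.1) else (z, 1).

Definition chain z t m := (chain_pair z t m).1.

Lemma chain0 z t : chain z t 0 = z. Proof. by []. Qed.
Lemma chain1 z t : chain z t 1 = 1. Proof. by []. Qed.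
Lemma chainSS z t m : chain z t m.+2 = t * chain z t m.+1 - chain z t m.
Proof. by []. Qed.

(** A Cassini identity: the left side is invariant under the recurrence. *)
Lemma chain_det z t m :
  chain z t m.+1 ^+ 2 - chain z t m * chain z t m.+2 = 1 - z * (t - z).
Proof.
elim: m => [|m IHm]; first by rewrite !chainSS chain1 chain0; ring.
by rewrite -IHm !chainSS; ring.
Qed.

Lemma chain_addS z t q m : chain z t (q + m).+1 =
  chain z t q.+1 * chain 0 t m.+1 - chain z t q * chain 0 t m.
Proof.
(* The recurrence has order two, so the induction carries two consecutive values. *)
suff [] : chain z t (q + m).+1 = chain z t q.+1 * chain 0 t m.+1 - chain z t q * chain 0 t m /\
  chain z t (q + m).+2 = chain z t q.+1 * chain 0 t m.+2 - chain z t q * chain 0 t m.+1 by [].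
elim: m => [|m [IH1 IH2]]; first by rewrite addn0 !chainSS chain1 chain0; split; ring.
by rewrite addnS; split => //; rewrite chainSS IH1 IH2 !chainSS; ring.
Qed.

Lemma chain_cross z t q m :
  chain z t (q + m).+1 * chain z t (q + m).+2 - chain z t q * chain z t q.+1 =
  chain 0 t m.+1 * (chain z t q.+1 * chain z t (q + m).+2 - chain z t (q + m).+1 * chain z t q).
Proof.
have det := chain_det 0 t m; rewrite mul0r subr0 in det.
(* The determinant of [chain 0] is 1; inserted as a factor of the subtracted product, it makes the
   identity polynomial. *)
rewrite -[X in _ - X]mulr1 -{}det -[in (q + m).+2]addnS !chain_addS !chainSS; ring.
Qed.

(* By Sturm separation: z <= 0 puts a sign change of chain z between 0 and 1. *)
Lemma chain0_gt0 z t p : z <= 0 -> (forall m, (1 <= m <= p.+2)%N -> 0 < chain z t m) ->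
  (0 < p)%N -> forall m, (m <= p)%N -> 0 < chain 0 t m.+1.
Proof.
move=> z0 zpos p0 m; have t0 : 0 <= t.
  have h1 := zpos 1%N isT; have h2 := zpos 2 isT; have h3 := zpos 3 p0.
  rewrite chainSS chain1 in h3.
  by rewrite -(pmulr_lge0 t h2); lra.
elim: m => [|m IHm] mp; first by rewrite chain1.
have um := IHm (ltnW mp); rewrite ltNge; apply/negP => h.
have := zpos m.+3; rewrite !ltnS mp => /(_ isT).
(* With U for [chain 0], Z_(m+3) = U_(m+3) - z U_(m+2). If U_(m+2) <= 0, then U_(m+3) < 0 and z
   U_(m+2) >= 0, so Z_(m+3) would be negative. *)
rewrite -[m.+2]add0n chain_addS chain1 chain0 mul1r [chain 0 t m.+3]chainSS.
have : t * chain 0 t m.+2 <= 0 by rewrite mulr_ge0_le0.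
have : 0 <= z * chain 0 t m.+2 by rewrite mulr_le0.
lra.
Qed.

(* [chain_gain s * x u ^+ k] is the contribution to vertex u of a pendant path of length s. *)
Definition chain_gain a d l s :=
  a + d * chain (- a / d) ((l - 2%:R * a) / d) s / chain (- a / d) ((l - 2%:R * a) / d) s.+1.

(** With D > 0 the constant of [chain_det], lengthening a path from s - 1 to s raises the gain by d
    D / (Z_s Z_(s+1)). The claim is thus Z_q Z_(q+1) < Z_(p+1) Z_(p+2), which [chain_cross] derives
    from the bound on the gains at u. *)
Lemma chain_gain_transfer a d l p q : 0 <= a -> a < l -> 0 < d -> (1 <= q <= p)%N ->
  (forall m, (1 <= m <= p.+2)%N -> 0 < chain (- a / d) ((l - 2%:R * a) / d) m) ->
  a + chain_gain a d l p.+1 + chain_gain a d l q.-1 < l ->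
  chain_gain a d l p.+1 + chain_gain a d l q.-1 < chain_gain a d l p + chain_gain a d l q.
Proof.
rewrite /chain_gain => a0 al d0 /andP[q0 qp]; case: q q0 qp => // q _ qp.
set z := - a / d; set t := _ / d => zpos lgain /=.
set Z := chain z t in zpos lgain *.
have Zq : 0 < Z q.+1 by apply: zpos; lia.
have ZqS : 0 < Z q.+2 by apply: zpos; lia.
have Zp : 0 < Z p.+1 by apply: zpos; lia.
have ZpS : 0 < Z p.+2 by apply: zpos; lia.
have dt : d * t = l - 2%:R * a by rewrite mulrC divfK ?gt_eqF.
have dz : d * z = - a by rewrite mulrC divfK ?gt_eqF.
have z0 : z <= 0 by rewrite /z mulNr oppr_le0 divr_ge0 // ltW.
have D0 : 0 < 1 - z * (t - z).
  have tz : 0 <= t - z.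
    by rewrite -(pmulr_rge0 _ d0) mulrBr dt dz; lra.
  by rewrite ltr_wpDr // oppr_ge0 mulr_le0_ge0.
(* The recurrence rewrites the gain of the shorter path, so that the gain bound compares Z_(p+1) /
   Z_(p+2) with Z_(q+2) / Z_(q+1), where q is now the predecessor of the original q. *)
have e1 : d * Z q / Z q.+1 = l - 2%:R * a - d * Z q.+2 / Z q.+1.
  by rewrite -dt /Z chainSS; field; rewrite gt_eqF.
have cross : Z p.+1 * Z q.+1 < Z q.+2 * Z p.+2.
  move: lgain => /=; rewrite e1 => h.
  have {}h : d * Z p.+1 / Z p.+2 < d * Z q.+2 / Z q.+1 by lra.
  move: h; rewrite -!mulrA ltr_pM2l // ltr_pdivrMr // mulrAC ltr_pdivlMr //.
have [m pE] : exists m, p = (q.+1 + m)%N by exists (p - q.+1)%N; lia.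
have big : Z q.+1 * Z q.+2 < Z p.+1 * Z p.+2.
  rewrite -subr_gt0 pE chain_cross -pE mulr_gt0 ?subr_gt0 //.
  by apply: (chain0_gt0 z0 zpos); lia.
have dq := chain_det z t q; have dp := chain_det z t p.
rewrite -/(Z _) in dq dp; rewrite -!/(Z _) in dq dp.
have eq1 : Z q.+1 / Z q.+2 - Z q / Z q.+1 = (1 - z * (t - z)) / (Z q.+1 * Z q.+2).
  by rewrite -dq; field; rewrite !gt_eqF.
have ep1 : Z p / Z p.+1 - Z p.+1 / Z p.+2 = - ((1 - z * (t - z)) / (Z p.+1 * Z p.+2)).
  by rewrite -dp; field; rewrite !gt_eqF.
have h : (1 - z * (t - z)) / (Z p.+1 * Z p.+2) < (1 - z * (t - z)) / (Z q.+1 * Z q.+2).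
  by rewrite ltr_pM2l // ltf_pV2 // posrE mulr_gt0.
rewrite -!mulrA; have : 0 < d * (Z p / Z p.+1 - Z p.+1 / Z p.+2 + (Z q.+1 / Z q.+2 - Z q / Z q.+1)).
  by rewrite mulr_gt0 // eq1 ep1; lra.
by rewrite !mulrDr !mulrN; lra.
Qed.
End Chain.

(** * Eigenvectors along a pendant path *)

Section PendantChain.
Variable R : rcfType.

(** Read from the free end, the end condition and the recurrence determine Y up to the factor Y
    s. *)
Lemma chain_of_recurrence (Y : nat -> R) (s : nat) (a d l : R) : d != 0 ->
  (forall m, (m.+1 < s)%N -> d * (Y m + Y m.+2) = (l - 2%:R * a) * Y m.+1) ->
  (forall m, m.+1 = s -> d * Y m = (l - a) * Y s) ->
  forall j, (j <= s)%N -> Y (s - j)%N = Y s * chain (- a / d) ((l - 2%:R * a) / d) j.+1.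
Proof.
move=> d0 rec last; set z := - a / d; set t := _ / d.
suff key j : (j < s)%N -> Y (s - j)%N = Y s * chain z t j.+1 /\
    Y (s - j.+1)%N = Y s * chain z t j.+2.
  case=> [_|j /key[]//]; by rewrite subn0 chain1 mulr1.
elim: j => [|j IHj] js.
  rewrite subn0 chain1 mulr1; split=> //; apply: (mulfI d0).
  rewrite last ?subn1 ?prednK // chainSS chain1 chain0 /z /t; field.
  exact: d0.
have [h1 h2] := IHj (ltnW js); split=> //; apply: (mulfI d0).
have /rec : ((s - j.+2).+2 < s.+1)%N by lia.
have -> : (s - j.+2).+2 = (s - j)%N by lia.
have -> : (s - j.+2).+1 = (s - j.+1)%N by lia.
rewrite chainSS h1 h2 mulrDr => /(canRL (addrK _)) ->; rewrite /t; field.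
exact: d0.
Qed.

Lemma recurrence_of_chain (s : nat) (a d l y0 : R) : 0 < d -> 0 < y0 ->
  (forall m, (1 <= m <= s.+1)%N -> 0 < chain (- a / d) ((l - 2%:R * a) / d) m) ->
  exists Y : nat -> R, [/\ Y 0%N = y0, forall m, (m <= s)%N -> 0 < Y m,
    forall m, (m.+1 < s)%N -> d * (Y m + Y m.+2) = (l - 2%:R * a) * Y m.+1 &
    forall m, m.+1 = s -> d * Y m = (l - a) * Y s].
Proof.
move=> d0 y00; set z := - a / d; set t := _ / d => Zpos.
have dn : d != 0 by rewrite gt_eqF.
have ZS : 0 < chain z t s.+1 by apply: Zpos; rewrite leqnn.
exists (fun m => y0 / chain z t s.+1 * chain z t (s.+1 - m)); split=> [|m ms|m ms|m ms].
- by rewrite subn0 divfK ?gt_eqF.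
- by rewrite mulr_gt0 ?divr_gt0 // Zpos; lia.
- have -> : (s.+1 - m = (s.+1 - m.+2).+2)%N by lia.
  have -> : (s.+1 - m.+1 = (s.+1 - m.+2).+1)%N by lia.
  by rewrite chainSS /t; field; rewrite gt_eqF.
have -> : (s.+1 - m = 2)%N by lia.
rewrite subSnn chainSS chain1 chain0 /t /z; field.
by rewrite gt_eqF.
Qed.

Lemma positive_root (k : nat) (r : R) : (0 < k)%N -> 0 < r ->
  exists y : R, 0 < y /\ y ^+ k = r.
Proof.
move=> k0 r0; pose p : {poly R} := 'X^k - r%:P.
have pE y : p.[y] = y ^+ k - r by rewrite /p !hornerE.
have r1 : 0 <= 1 + r by lra.
have [|y /andP[y0 _]] := poly_ivt r1 (_ : p.[0] <= 0 <= p.[1 + r]).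
  rewrite !pE expr0n gtn_eqF // sub0r oppr_le0 ltW //= subr_ge0.
  have h1 : 1 <= 1 + r by lra.
  by have := ler_eXnr k0 h1; lra.
rewrite rootE pE subr_eq0 => /eqP yk; exists y; split=> //.
by rewrite lt_def y0 andbT; apply: contraTneq r0 => y00; rewrite -yk y00 expr0n gtn_eqF ?ltxx.
Qed.

Variables (n : nat) (H : hypergraph) (u : vtx H) (s : nat) (a l : R).
Hypotheses (a_lt1 : a < 1) (a_lt_l : a < l).
Local Notation k := n.+2.
Local Notation HA := (attach k H u s).
Local Notation c := ((1 - a) / (l - a)).
Local Notation F := (local_form k a).

(* On a pendant edge with joints v, w each other vertex satisfies x ^ k = c * prod,
   which makes the product of x over the edge equal to c^(n/2) (x_v x_w)^(k/2). *)
Definition coupling (m : nat) (b r : R) : R := (1 - b) * Num.sqrt ((1 - b) / (r - b)) ^+ m.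
Local Notation d := (coupling n a l).
Local Notation Z := (chain (- a / d) ((l - 2%:R * a) / d)).

Let c_gt0 : 0 < c. Proof. by rewrite divr_gt0 // subr_gt0. Qed.
Let g_gt0 : 0 < Num.sqrt c ^+ n. Proof. by rewrite exprn_gt0 // sqrtr_gt0. Qed.
Let g_sqr : (Num.sqrt c ^+ n) ^+ 2 = c ^+ n.
Proof. by rewrite exprAC sqr_sqrtr // ltW. Qed.

Lemma coupling_gt0 : 0 < d.
Proof. by rewrite mulr_gt0 // subr_gt0. Qed.

(** The indices [lift ord0 j] are the non-joint vertices of the edge; each lies in this edge only,
    so its equation can be solved for x^k. *)
Lemma leaf_eq (x : vtx HA -> R) (i : 'I_s) (j : 'I_n) :
  F x (inr (i, lift ord0 j)) = l * x (inr (i, lift ord0 j)) ^+ k <->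
  x (inr (i, lift ord0 j)) ^+ k = c * pendant_prod x i.
Proof.
rewrite local_form_attach_inr /= addr0.
have la : l - a != 0 by rewrite gt_eqF // subr_gt0.
set X := _ ^+ k; split=> h.
  apply: (mulfI la).
  have -> : (l - a) * (c * pendant_prod x i) = (1 - a) * pendant_prod x i by field.
  by rewrite mulrBl -h; ring.
by rewrite h; field.
Qed.

(** Q is the edge product itself in [pendant_extract] and the prescribed value of that product in
    [pendant_extend]. *)
Lemma pendant_prod_exp (x : vtx HA -> R) (i : 'I_s) (Q : R) :
  (forall j : 'I_n, x (inr (i, lift ord0 j)) ^+ k = c * Q) ->
  pendant_prod x i ^+ k = x (joint u i) ^+ k * x (joint u i.+1) ^+ k * (c * Q) ^+ n.
Proof.
move=> leaf; rewrite pendant_prodE big_ord_recl joint_succ mulrA 2!exprMn; congr (_ * _).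
rewrite -prodrXl; under eq_bigr => j _ do rewrite leaf.
by rewrite prodr_const card_ord.
Qed.

(** Y stands for the k/2-th powers at the joints; the relation x^k = Y^2 avoids half-integer
    exponents. The last joint has degree 1, the others degree 2. *)
Lemma local_form_joint (x : vtx HA -> R) (Y : nat -> R) :
  (forall m, (m <= s)%N -> x (joint u m) ^+ k = Y m ^+ 2) ->
  (forall i : 'I_s, (1 - a) * pendant_prod x i = d * Y i * Y i.+1) ->
  (forall i : 'I_s, F x (inr (i, ord0)) = (if i.+1 == s then a * Y i.+1 + d * Y i
     else 2%:R * a * Y i.+1 + d * (Y i + Y i.+2)) * Y i.+1).
Proof.
move=> xY xP i; have ji := joint_succ n u i.
rewrite local_form_attach_inr /= xP -ji xY //.
have [iS|iS] := eqVneq i.+1 s.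
  rewrite big_pred0 ?addr0; first by rewrite expr2; ring.
  by move=> i'; apply: ltn_eqF; rewrite iS.
have i1 : (i.+1 < s)%N by rewrite ltn_neqAle iS ltn_ord.
rewrite (eq_bigl (pred1 (Ordinal i1))) ?big_pred1_eq ?xP /= => [|i'] //.
by rewrite expr2; ring.
Qed.

Lemma pendant_extract (x : vtx HA -> R) : (forall v, 0 < x v) ->
  (forall y, F x (inr y) = l * x (inr y) ^+ k) ->
  (forall m, (1 <= m <= s.+1)%N -> 0 < Z m) /\
  forall v, F x (inl v) = F (x \o inl) v +
    (if v == u then chain_gain a d l s * x (inl u) ^+ k else 0).
Proof.
move=> x0 xl; have d0 := coupling_gt0.
have P0 i : 0 < pendant_prod x i by apply: prodr_gt0.
pose Y m := Num.sqrt (x (joint u m) ^+ k).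
have Y0 m : 0 < Y m by rewrite sqrtr_gt0 exprn_gt0.
have Y2 m : x (joint u m) ^+ k = Y m ^+ 2 by rewrite sqr_sqrtr // exprn_ge0 // ltW.
have xP (i : 'I_s) : (1 - a) * pendant_prod x i = d * Y i * Y i.+1.
  have leaf j := (leaf_eq x i j).1 (xl _).
  have Pk := pendant_prod_exp leaf; rewrite !Y2 // in Pk.
  have Yi := Y0 i; have YiS := Y0 i.+1.
  suff -> : pendant_prod x i = Num.sqrt c ^+ n * (Y i * Y i.+1) by rewrite /coupling; ring.
  apply: (pexpIrn (n := 2)); rewrite ?nnegrE // ?ltW ?mulr_gt0 //.
  (* After squaring, the factor P^n produces P^k, which [pendant_prod_exp] evaluates. *)
  apply: (mulfI (lt0r_neq0 (exprn_gt0 n (P0 i)))).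
  rewrite -exprD addn2 Pk [(c * _) ^+ n]exprMn [(Num.sqrt c ^+ n * _) ^+ 2]exprMn g_sqr.
  by set C := c ^+ n; set P := _ ^+ n; ring.
have Yrec m : (m.+1 < s)%N -> d * (Y m + Y m.+2) = (l - 2%:R * a) * Y m.+1.
  move=> ms; have := local_form_joint (fun m _ => Y2 m) xP (Ordinal (ltnW ms)).
  rewrite xl -joint_succ Y2 ltn_eqF //= expr2 mulrA => /(mulIf (lt0r_neq0 (Y0 m.+1))).
  by move=> h; rewrite mulrBl h; ring.
have Ylast m : m.+1 = s -> d * Y m = (l - a) * Y s.
  move=> ms; have ms' : (m < s)%N by rewrite -ms.
  have := local_form_joint (fun m _ => Y2 m) xP (Ordinal ms').
  rewrite xl -joint_succ Y2 /= ms eqxx expr2 mulrA => /(mulIf (lt0r_neq0 (Y0 s))).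
  by move=> h; rewrite mulrBl h; ring.
have YZ := chain_of_recurrence (lt0r_neq0 d0) Yrec Ylast.
have Zpos m : (1 <= m <= s.+1)%N -> 0 < Z m.
  case: m => // m; rewrite !ltnS => /= /YZ h.
  by rewrite -(pmulr_rgt0 _ (Y0 s)) -h.
split=> // v; rewrite local_form_attach_inl; congr (_ + _).
case: eqP => // _; have Y_0 : Y 0%N = Y s * Z s.+1 by rewrite -YZ ?subnn.
have Z1 : Z s.+1 != 0 by rewrite lt0r_neq0 // Zpos ?leqnn.
rewrite (Y2 0%N : x (inl u) ^+ k = _) /chain_gain.
(* A path of length 0 has gain a + d z = 0, in agreement with the empty sum. *)
have [s0|s0] := posnP s.
  rewrite big_pred0 => [|[i +]]; last by rewrite s0.
  by rewrite s0 chain0 chain1 mulrC mulrA; field; rewrite lt0r_neq0.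
rewrite (eq_bigl (pred1 (Ordinal s0))) ?big_pred1_eq ?xP //=.
have Y1 : Y 1%N = Y s * Z s.
  have := YZ s.-1 (leq_pred s); rewrite prednK //.
  by have -> : (s - s.-1 = 1)%N by lia.
by rewrite Y1 Y_0; field.
Qed.

(** Converse construction: the chain gives the values Y at the joints, Y fixes the product over each
    edge, and k-th roots give y. *)
Lemma pendant_extend (x : vtx H -> R) : (forall v, 0 < x v) ->
  (forall m, (1 <= m <= s.+1)%N -> 0 < Z m) ->
  exists y : vtx HA -> R, [/\ forall v, 0 < y v, forall v, y (inl v) = x v &
    forall w, F y (inr w) = l * y (inr w) ^+ k].
Proof.
move=> x0 Zpos; have d0 := coupling_gt0.
have sx0 : 0 < Num.sqrt (x u ^+ k) by rewrite sqrtr_gt0 exprn_gt0.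
have [Y [Y_0 Y0 Yrec Ylast]] := recurrence_of_chain d0 sx0 Zpos.
pose g := Num.sqrt c ^+ n.
pose target (w : 'I_s * 'I_n.+1) :=
  if w.2 == ord0 then Y w.1.+1 ^+ 2 else c * (g * (Y w.1 * Y w.1.+1)).
have target0 w : 0 < target w.
  case: w => i j; rewrite /target /=; case: ifP => _; first by rewrite exprn_gt0 ?Y0.
  by rewrite mulr_gt0 // mulr_gt0 // mulr_gt0 ?Y0 // ltnW.
have [r rP] := fin_all_exists (fun w => positive_root (ltn0Sn n.+1) (target0 w)).
pose y (v : vtx HA) := match v with inl v => x v | inr w => r w end.
have y0 v : 0 < y v by case: v => [v|w] /=; [apply: x0|case: (rP w)].
have yY m : (m <= s)%N -> y (joint u m) ^+ k = Y m ^+ 2.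
  case: m => [_|m ms].
    by rewrite Y_0 sqr_sqrtr // exprn_ge0 // ltW.
  by rewrite (joint_succ n u (Ordinal ms)) /= (proj2 (rP _)).
have yP (i : 'I_s) : pendant_prod y i = g * (Y i * Y i.+1).
  have leaf (j : 'I_n) : y (inr (i, lift ord0 j)) ^+ k = c * (g * (Y i * Y i.+1)).
    by rewrite /= (proj2 (rP _)).
  have := pendant_prod_exp leaf; rewrite !yY ?ltn_ord ?(ltnW (ltn_ord i)) // => Pk.
  have Yi := Y0 i (ltnW (ltn_ord i)); have YiS := Y0 i.+1 (ltn_ord i).
  have W0 : 0 < g * (Y i * Y i.+1) by rewrite mulr_gt0 // (mulr_gt0 Yi YiS).
  have P0 : 0 < pendant_prod y i by apply: prodr_gt0.
  apply: (pexpIrn (n := k)); rewrite ?nnegrE ?(ltW W0) ?(ltW P0) //=.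
  rewrite Pk [(c * _) ^+ n]exprMn -g_sqr -/g [RHS]exprS [in RHS]exprS.
  by set W := (g * _) ^+ n; ring.
have yP' (i : 'I_s) : (1 - a) * pendant_prod y i = d * Y i * Y i.+1.
  by rewrite yP /coupling -/g; ring.
exists y; split=> // -[i j].
have [->|[j' ->]] : j = ord0 \/ exists j', j = lift ord0 j'.
  by case: (unliftP ord0 j) => [j' ->|->]; [right; exists j'|left].
  rewrite (local_form_joint yY yP') -joint_succ yY // expr2 mulrA; congr (_ * _).
  have [iS|iS] := eqVneq i.+1 s.
    by have := Ylast i iS; rewrite iS => ->; ring.
  by rewrite Yrec; [ring|rewrite ltn_neqAle iS ltn_ord].
by apply/(leaf_eq y i j'); rewrite yP /= (proj2 (rP _)).
Qed.
End PendantChain.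

(** * Comparison of the two attachments *)

Section Comparison.
Variables (R : rcfType) (n : nat) (a : R) (G : hypergraph) (u : vtx G).
Local Notation k := n.+2.
Hypotheses (a_ge0 : 0 <= a) (a_lt1 : a < 1).
Hypotheses (G_unif : uniform k G) (G_conn : connected G) (G_edges : edges G != set0).

Definition perron_pair (H : hypergraph) (r : R) (x : vtx H -> R) :=
  (forall v, 0 < x v) /\ forall v, local_form k a x v = r * x v ^+ k.

Lemma vertex_in_edge (v : vtx G) : exists2 e, e \in edges G & v \in e.
Proof.
have [e eE] := set0Pn _ G_edges.
have [w we] : exists w, w \in e by apply/set0Pn; rewrite -card_gt0 (G_unif eE).
have /connectP[[|z p]] := G_conn v w; first by move=> _ /= <-; exists e.
by move=> /= /andP[/exists_inP[e' e'E /andP[ve' _]] _] _; exists e'.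
Qed.

Lemma uniform_Gupq p q : uniform k (Gupq k G u p q).
Proof. by do 2!apply: uniform_attach. Qed.

Lemma connected_Gupq p q : connected (Gupq k G u p q).
Proof. by do 2!apply: connected_attach. Qed.

Lemma perron_Gupq_lt p q r1 r2 (x1 : vtx (Gupq k G u p q) -> R)
    (x2 : vtx (Gupq k G u p.+1 q.-1) -> R) : (1 <= q <= p)%N ->
  perron_pair r1 x1 -> perron_pair r2 x2 -> r2 < r1.
Proof.
move=> qp [x10 x1r] [x20 x2r]; have [q0 q_le_p] := andP qp.
have [e eE ue] := vertex_in_edge u.
have al : a < r2.
  have ue' : inl (inl u) \in lift_edge _ ('I_q.-1 * 'I_k.-1)%type (lift_edge _ ('I_p.+1 * 'I_k.-1)%type e).
    by do 2!apply: imset_f.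
  have := local_form_gt0 k a_ge0 a_lt1 x20 _ ue'.
  rewrite x2r ltr_pM2r ?exprn_gt0 //; apply.
  by do 2!apply: lift_edge_mem.
have [Zq outer] := pendant_extract a_lt1 al x20 (fun y => x2r (inr y)).
(* The outer path meets the inner graph at u only, so removing it keeps the equations at the new
   vertices of the inner path. *)
have inner_eq y : local_form k a (x2 \o inl) (inr y) = r2 * (x2 \o inl) (inr y) ^+ k.
  by have := outer (inr y); rewrite x2r addr0 => <-.
have [Zp inner] := pendant_extract a_lt1 al (fun v => x20 (inl v)) inner_eq.
pose z v := x2 (inl (inl v)).
have z0 v : 0 < z v by apply: x20.
have zr v : local_form k a z v + (if v == u then
    (chain_gain a (coupling n a r2) r2 p.+1 + chain_gain a (coupling n a r2) r2 q.-1) * z v ^+ k else 0) = r2 * z v ^+ k.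
  have := outer (inl v); rewrite x2r inner (inj_eq inl_inj) => ->.
  by case: eqP => [->|_]; rewrite /z /= ?addr0 //; ring.
have d0 := coupling_gt0 n a_lt1 al.
(* G has an edge at u, which contributes more than a z_u^k; the two gains must fit into the rest. *)
have gain_lt : a + chain_gain a (coupling n a r2) r2 p.+1 + chain_gain a (coupling n a r2) r2 q.-1 < r2.
  rewrite -(ltr_pM2r (exprn_gt0 k (z0 u))) -zr eqxx -addrA mulrDl ltrD2r.
  exact: local_form_gt0 z0 eE ue.
have Zpos m : (1 <= m <= p.+2)%N -> 0 < chain (- a / coupling n a r2) ((r2 - 2%:R * a) / coupling n a r2) m by apply: Zp.
have gain := chain_gain_transfer a_ge0 al d0 qp Zpos gain_lt.
have [|y1 [y10 y1z y1r]] := @pendant_extend R n G u p a r2 a_lt1 al z z0.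
  by move=> m mp; apply: Zpos; lia.
have [|y2 [y20 y2y1 y2r]] := @pendant_extend R n (attach k G u p) (inl u) q a r2 a_lt1 al y1 y10.
  by move=> m mq; apply: Zpos; lia.
have [_ outer'] := pendant_extract a_lt1 al y20 y2r.
have [_ inner'] := pendant_extract a_lt1 al y10 y1r.
have ext H (f g : vtx H -> R) v : f =1 g -> local_form k a f v = local_form k a g v.
  move=> fg; apply: eq_bigr => e' _; rewrite fg; congr (_ + _ * _).
  by apply: eq_bigr => w _.
(* The glued vector satisfies the eigenequation for r2 except at u, where the difference of the
   gains is a positive surplus. *)
have y2F v : local_form k a y2 v = r2 * y2 v ^+ k + (if v == inl (inl u) then
   (chain_gain a (coupling n a r2) r2 p + chain_gain a (coupling n a r2) r2 q -
    (chain_gain a (coupling n a r2) r2 p.+1 + chain_gain a (coupling n a r2) r2 q.-1)) * z u ^+ k else 0).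
  case: v => [[v|w]|w]; last by rewrite y2r addr0.
    rewrite outer' (ext _ _ y1) // inner' (ext _ _ z) // !(inj_eq inl_inj).
    rewrite /= !y2y1 !y1z -zr; case: eqP => [->|_]; last by ring.
    by ring.
  by rewrite outer' (ext _ _ y1) // y1r /= y2y1 !addr0.
have gtsum : r2 * \sum_v y2 v ^+ k < \sum_v local_form k a y2 v.
  rewrite (eq_bigr _ (fun v _ => y2F v)) big_split /= -mulr_sumr ltrDl.
  rewrite -big_mkcond big_pred1_eq mulr_gt0 ?exprn_gt0 // subr_gt0.
  exact: gain.
have := rayleigh_le (isT : (2 <= k)%N) (@uniform_Gupq p q) a_lt1 x10 x1r (fun v => ltW (y20 v)).
move=> /(lt_le_trans gtsum); rewrite ltr_pM2r //.
by apply: lt_le_trans (_ : 0 < y2 (inl (inl u)) ^+ k) _; rewrite ?exprn_gt0 // (bigD1 (inl (inl u))) //= lerDl sumr_ge0 // => v _; rewrite exprn_ge0 // ltW.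
Qed.
End Comparison.

(** * Spectral radius *)

Section SpectralRadius.
Variables (C : numClosedFieldType) (n : nat) (H : hypergraph).
Local Notation k := n.+2.
Local Notation R := (realOf C).
Hypothesis H_unif : uniform k H.

(** For an edge e at i, the tuples completing i to e are the (k-1)! enumerations of the rest of e,
    which cancels the weight of the entry. *)
Lemma sum_adj_entry (x : vtx H -> C) (i : vtx H) :
  \sum_(t : {ffun 'I_k.-1 -> vtx H}) adj_entry C k H i t * \prod_(j < k.-1) x (t j) =
  \sum_(e in edges H | i \in e) \prod_(w in e | w != i) x w.
Proof.
have f0 : ((k.-1)`!)%:R != 0 :> C by rewrite pnatr_eq0 -lt0n fact_gt0.
pose im (t : {ffun 'I_k.-1 -> vtx H}) := i |: [set t j | j in 'I_k.-1].
rewrite (bigID (fun t => im t \in edges H)) /= [X in _ + X]big1 ?addr0; last first.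
  by move=> t /negPf tE; rewrite /adj_entry tE mul0r.
rewrite (partition_big im (fun e => (e \in edges H) && (i \in e))) /=; last first.
  by move=> t tE; rewrite tE setU11.
apply: eq_bigr => e /andP[eE ie].
pose A := e :\ i.
have cA : #|A| = n.+1 by have := cardsD1 i e; rewrite ie (H_unif eE) => -[].
pose S := [set t : {ffun 'I_k.-1 -> vtx H} in ffun_on (mem A) | injectiveb t].
have cS : #|S| = (k.-1)`!.
  by rewrite card_inj_ffuns_on card_ord cA ffactnn.
pose T (t : {ffun 'I_k.-1 -> vtx H}) := [set t j | j in 'I_k.-1].
have TP t : t \in S -> T t = A /\ injective t.
  rewrite inE => /andP[/ffun_onP tA /injectiveP tinj]; split=> //.
  apply/eqP; rewrite eqEcard cA card_imset // card_ord leqnn andbT.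
  by apply/subsetP => _ /imsetP[j _ ->]; apply: tA.
rewrite (eq_bigl (mem S)) => [|t]; last first.
  apply/andP/idP => [[_ /eqP ime]|/TP[TA _]]; last first.
    have -> : im t = e by rewrite /im -/(T t) TA setD1K.
    by rewrite eqxx.
  (* As e has k vertices, k - 1 indices can supply the rest only if t is injective and avoids i. *)
  have cT : (#|T t| <= n.+1)%N by rewrite -[X in (_ <= X)%N]card_ord leq_imset_card.
  have := H_unif eE; rewrite -ime /im -/(T t) cardsU1.
  case iT : (i \in T t) => /= ce; first by rewrite add0n in ce; rewrite ce ltnn in cT.
  rewrite inE; apply/andP; split.
    apply/ffun_onP => j; rewrite /A -ime !inE; apply/andP; split; last first.
      by apply/orP; right; apply: imset_f.
    by apply: contraFneq iT => <-; apply: imset_f.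
  have /imset_injP tinj : #|T t| == #|'I_k.-1| by rewrite card_ord; apply/eqP; case: ce.
  by apply/injectiveP => j j' /tinj; apply.
transitivity (\sum_(t in S) ((k.-1)`!)%:R^-1 * \prod_(w in A) x w).
  apply: eq_bigr => t /TP[TA tinj]; congr (_ * _).
    by rewrite /adj_entry -/(T t) TA setD1K // eE.
  by rewrite -TA big_imset //= => j j' _ _; apply: tinj.
rewrite sumr_const cS -[LHS]mulr_natl mulrA divff // mul1r; apply: eq_bigl => w.
by rewrite !inE andbC.
Qed.

Lemma Aalpha_apply_mul (alpha : C) (x : vtx H -> C) (i : vtx H) :
  x i * Aalpha_apply C k alpha H x i = local_form k alpha x i.
Proof.
have diag : \sum_(t : {ffun 'I_k.-1 -> vtx H}) diag_entry C k H i t * \prod_(j < k.-1) x (t j) =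
    (deg H i)%:R * x i ^+ k.-1.
  rewrite (bigD1 [ffun=> i]) //= [X in _ + X]big1 ?addr0 => [|t ti].
    rewrite /diag_entry; case: forallP => [_|h]; last by case: h => j; rewrite ffunE.
    rewrite (eq_bigr (fun=> x i)) => [|j _]; last by rewrite ffunE.
    by rewrite prodr_const card_ord.
  rewrite /diag_entry; case: forallP => [h|_]; last by rewrite mul0r.
  by case/eqP: ti; apply/ffunP => j; rewrite ffunE; apply/eqP.
rewrite /Aalpha_apply /Aalpha_entry.
under eq_bigr => t _ do rewrite mulrDl -!mulrA.
rewrite big_split -!mulr_sumr /= diag sum_adj_entry /local_form big_split /= mulrDr.
congr (_ + _); last first.
  rewrite mulrCA -[RHS]mulr_sumr; congr (_ * _); rewrite mulr_sumr; apply: eq_bigr => e /andP[_ ie].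
  by rewrite [RHS](bigD1 i).
have shift (N : nat) : x i * (alpha * (N%:R * x i ^+ k.-1)) = alpha * x i ^+ k *+ N.
  by rewrite -[RHS]mulr_natl [x i ^+ k]exprS; ring.
by rewrite sumr_const shift /deg cardsE.
Qed.

Lemma val_local_form (a : R) (z : vtx H -> R) (v : vtx H) :
  local_form k (val a) (fun w => val (z w)) v = val (local_form k a z v).
Proof.
rewrite /local_form rmorph_sum; apply: eq_bigr => e _.
rewrite rmorphD; congr (_ + _); first by rewrite rmorphM rmorphXn.
by rewrite rmorphM rmorphB rmorph1 rmorph_prod.
Qed.

(** For any eigenpair, the triangle inequality makes the moduli y of the entries satisfy [|lam|] y^k
    <= F y at each vertex; summing and applying [rayleigh_le] bounds [|lam|] by r. *)
Lemma spectral_radius_perron (a r : R) (z : vtx H -> R) (v0 : vtx H) :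
  0 <= a -> a < 1 -> perron_pair n a r z ->
  is_spectral_radius C k (val a) H (val r).
Proof.
move=> a0 a1 [z0 zr].
have r0 : 0 <= r.
  rewrite -(pmulr_lge0 _ (exprn_gt0 k (z0 v0))) -zr.
  by apply: local_form_ge0 => // w; apply: ltW.
split.
  exists (val r); split; last by rewrite ger0_norm.
  exists (fun v => val (z v)); split=> [|v].
    by exists v0; apply: lt0r_neq0; apply: z0.
  have zv : val (z v) != 0 by apply: lt0r_neq0; apply: z0.
  apply: (mulfI zv); rewrite Aalpha_apply_mul val_local_form zr rmorphM rmorphXn /=.
  by rewrite [RHS]mulrCA -exprS.
move=> lam [x [[i0 xi0] xl]].
pose y v : R := RealOf (normr_real (x v)).
pose L : R := RealOf (normr_real lam).
have y0 v : 0 <= y v by apply: normr_ge0.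
have ly v : L * y v ^+ k <= local_form k a y v.
  rewrite complexOf_le -[leRHS](val_local_form a y v) rmorphM rmorphXn /=.
  have -> : `|lam| * `|x v| ^+ k = `|local_form k (val a) x v|.
    by rewrite -Aalpha_apply_mul xl -normrX -normrM [in RHS]mulrCA [x v ^+ k]exprS.
  rewrite /local_form; apply: le_trans (ler_norm_sum _ _ _) _.
  apply: ler_sum => e _; apply: le_trans (ler_normD _ _) _.
  have va0 : 0 <= val a by exact: a0.
  have va1 : 0 <= 1 - val a by rewrite subr_ge0; exact: (ltW a1).
  by rewrite [`|val a * _|]normrM [`|(1 - _) * _|]normrM normrX normr_prod (ger0_norm va0) (ger0_norm va1).
have ysum : 0 < \sum_v y v ^+ k.
  rewrite (bigD1 i0) //= ltr_wpDr ?sumr_ge0 // => [v _|]; first by rewrite exprn_ge0.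
  by rewrite exprn_gt0 // /y complexOf_lt /= normr_gt0.
have := rayleigh_le (isT : (2 <= k)%N) H_unif a1 z0 zr y0.
have : L * \sum_v y v ^+ k <= \sum_v local_form k a y v.
  by rewrite mulr_sumr; apply: ler_sum.
by move=> h1 /(le_trans h1); rewrite ler_pM2r.
Qed.
End SpectralRadius.

Unset Implicit Arguments.
Theorem theorem4p3 (C : numClosedFieldType) (k : nat) (alpha : C)
  (G : hypergraph) (u : vtx G) (p q : nat) :
  (2 <= k)%N -> 0 <= alpha -> alpha < 1 ->
  uniform k G -> connected G -> edges G != set0 ->
  (1 <= q)%N -> (q <= p)%N ->
  exists r1 r2 : C,
    is_spectral_radius C k alpha (Gupq k G u p q) r1 /\
    is_spectral_radius C k alpha (Gupq k G u p.+1 q.-1) r2 /\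
    r2 < r1.
Proof.
move=> k2 alpha0 alpha1; case: k k2 => [|[|n]] // _ G_unif G_conn G_edges q0 qp.
pose a : realOf C := RealOf (ger0_real alpha0).
have a0 : 0 <= a by rewrite complexOf_le.
have a1 : a < 1 by rewrite complexOf_lt.
have unif p' q' : uniform n.+2 (Gupq n.+2 G u p' q') by apply: uniform_Gupq.
have conn p' q' : connected (Gupq n.+2 G u p' q') by apply: connected_Gupq.
have pairs p' q' : exists r x, perron_pair (H := Gupq n.+2 G u p' q') n a r x.
  exact: (@perron _ n.+2 _ (Gupq n.+2 G u p' q') (inl (inl u)) isT (unif p' q') (conn p' q') a0 a1).
have [r1 [x1 x1P]] := pairs p q; have [r2 [x2 x2P]] := pairs p.+1 q.-1.
exists (complexOf r1), (complexOf r2); split; last split.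
- exact: (spectral_radius_perron (unif p q) (inl (inl u)) a0 a1 x1P).
- exact: (spectral_radius_perron (unif p.+1 q.-1) (inl (inl u)) a0 a1 x2P).
by apply: (perron_Gupq_lt a0 a1 G_unif G_conn G_edges _ x1P x2P); rewrite q0.
Qed.
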